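(* Let $G$ be a $2$-edge-connected graph with vertex set $V$, let $\emptyset\subsetneq S\subsetneq V$ be such that $\delta(S)$ is an inclusion-wise minimal cut, and let $e_1\in E(G[S])$, $e_2\in E(G[V\setminus S])$. For $W\in\{S,V\setminus S\}$ and a bridge $f\notin\{e_1,e_2\}$ of $G[W]$, let $\delta(W,f)\subseteq\delta(S)$ be the set of edges of $\delta(S)$ having an endpoint in the connected component of $G[W]-f$ that contains neither $e_1$ nor $e_2$. Then the connectivity cut inequality $$2x_{e_1}-x(\delta(S))+2x_{e_2}\le 2$$ defines a facet of $\mathrm{TECSP}(G)$ if and only if one of the following holds: (i) ($e_1$ is a bridge of $G[S]$ or $e_2$ is a bridge of $G[V\setminus S]$) and $|\delta(S)|=2$; (ii) $e_1$ is not a bridge of $G[S]$, $e_2$ is not a bridge of $G[V\setminus S]$, and for every $W\in\{S,V\setminus S\}$ and every bridge $f$ of $G[W]$ we have $|\delta(W,f)|=1$.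
   Context: All graphs are finite, simple and undirected. For $\emptyset\subsetneq S\subsetneq V(G)$, $\delta(S)$ is the set of edges with exactly one endpoint in $S$ (a cut); $G[S]$ is the induced subgraph on $S$; $G[W]-f$ is $G[W]$ with edge $f$ deleted. An edge is a bridge of a graph if its removal increases the number of connected components. A graph is $2$-edge-connected if it is connected and has no bridges; the empty graph and a single vertex are $2$-edge-connected. For $F\subseteq E(G)$, $x(F)=\sum_{f\in F}x_f$. $\chi^H\in\{0,1\}^{E(G)}$ is the incidence vector of $E(H)$, and $\mathrm{TECSP}(G)=\mathrm{conv}\{\chi^H : H\subseteq G\text{ is }2\text{-edge-connected}\}\subseteq\mathbb{R}^{E(G)}$. A facet is a face of dimension $\dim(\mathrm{TECSP}(G))-1$. *)

(* Defs.v *)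
From HB Require Import structures.
From mathcomp Require Import all_boot all_order all_algebra.
From mathcomp Require Import reals.
Set Implicit Arguments. Unset Strict Implicit. Unset Printing Implicit Defensive.
Import Order.TTheory GRing.Theory Num.Theory.

(* A finite simple graph: vertex set = the finType T, edge set E : {set {set T}}
   whose elements are 2-element subsets of T. *)
Section Graphs.
Variable T : finType.

Definition simple_edges (E : {set {set T}}) := forall f, f \in E -> #|f| = 2.

Definition adj (F : {set {set T}}) : rel T := fun u v => [set u; v] \in F.

Definition comp (W : {set T}) (F : {set {set T}}) (u : T) : {set T} :=
  [set v in W | connect (adj F) u v].

Definition ncomp (W : {set T}) (F : {set {set T}}) : nat :=
  #|[set comp W F u | u in W]|.

Definition bridge (W : {set T}) (F : {set {set T}}) (f : {set T}) : bool :=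
  (f \in F) && (ncomp W F < ncomp W (F :\ f)).

(* (W, F) is 2-edge-connected: connected (at most one component, so the
   empty graph and single vertices qualify) and without bridges *)
Definition two_edge_connected (W : {set T}) (F : {set {set T}}) : Prop :=
  ncomp W F <= 1 /\ forall f, ~~ bridge W F f.

Definition subgraph (E : {set {set T}}) (W : {set T}) (F : {set {set T}}) : Prop :=
  F \subset E /\ forall f, f \in F -> f \subset W.

Definition induced (E : {set {set T}}) (W : {set T}) : {set {set T}} :=
  [set f in E | f \subset W].

Definition cut (E : {set {set T}}) (S : {set T}) : {set {set T}} :=
  [set f in E | #|f :&: S| == 1%N].

Definition minimal_cut (E : {set {set T}}) (S : {set T}) : Prop :=
  forall S' : {set T}, S' != set0 -> S' != setT ->
    cut E S' \subset cut E S -> cut E S' = cut E S.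

Definition deltaWf (E : {set {set T}}) (S e1 e2 W f : {set T}) : {set {set T}} :=
  [set g in cut E S | [exists v in g, (v \in W) &&
      ~~ (e1 \subset comp W (induced E W :\ f) v) &&
      ~~ (e2 \subset comp W (induced E W :\ f) v)]].

(* ---- polyhedral notions in R^{E}: a vector is a function {set T} -> R,
   of which only the coordinates indexed by E matter ---- *)
Variable R : realType.
Local Open Scope ring_scope.

Definition vec := {set T} -> R.

Definition lin_indep (E : {set {set T}}) (k : nat) (v : 'I_k -> vec) : Prop :=
  forall c : 'I_k -> R,
    (forall f, f \in E -> \sum_(i < k) c i * v i f = 0) -> forall i, c i = 0.

Definition aff_indep (E : {set {set T}}) (k : nat) (p : 'I_k.+1 -> vec) : Prop :=
  lin_indep E (fun i : 'I_k => fun f => p (lift ord0 i) f - p ord0 f).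

Definition affdim_ge (E : {set {set T}}) (P : vec -> Prop) (k : nat) : Prop :=
  exists p : 'I_k.+1 -> vec, (forall i, P (p i)) /\ aff_indep E p.

Definition is_affdim (E : {set {set T}}) (P : vec -> Prop) (d : int) : Prop :=
  (d = -1 /\ forall x, ~ P x) \/
  (exists n : nat, d = n%:Z /\ affdim_ge E P n /\ ~ affdim_ge E P n.+1).

Definition conv (E : {set {set T}}) (Q : vec -> Prop) : vec -> Prop :=
  fun x => exists (n : nat) (p : 'I_n -> vec) (w : 'I_n -> R),
    (forall i, Q (p i)) /\ (forall i, 0 <= w i) /\ \sum_(i < n) w i = 1 /\
    forall f, f \in E -> x f = \sum_(i < n) w i * p i f.

Definition tec_vectors (E : {set {set T}}) : vec -> Prop :=
  fun y => exists (W : {set T}) (F : {set {set T}}),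
    subgraph E W F /\ two_edge_connected W F /\
    forall f, f \in E -> y f = (f \in F)%:R.

Definition TECSP (E : {set {set T}}) : vec -> Prop := conv E (tec_vectors E).

Definition defines_facet (E : {set {set T}}) (P : vec -> Prop)
    (lhs : vec -> R) (b : R) : Prop :=
  (forall x, P x -> lhs x <= b) /\
  exists d : int, is_affdim E P d /\
    is_affdim E (fun x => P x /\ lhs x = b) (d - 1).

End Graphs.

(* Main.v *)
Require Import Defs.
From HB Require Import structures.
From mathcomp Require Import all_boot all_order all_algebra.
From mathcomp Require Import boolp reals.
Import Order.TTheory GRing.Theory Num.Theory.
Set Implicit Arguments. Unset Strict Implicit. Unset Printing Implicit Defensive.

(**
Every face of TECSP(G) is spanned by incidence vectors, the origin is a vertex of TECSP(G) and
lies off the hyperplane of the inequality, so the face is a facet iff every linear functional [a]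
vanishing on the tight 2-edge-connected subgraphs vanishes on all 2-edge-connected subgraphs.

Necessity: if [e1] is a bridge of G[S], the functional x(delta(S)) - 2 x_{e1} vanishes on all
tight subgraphs, hence on G, and |delta(S)| = 2; if [f] is a bridge of G[W], the same argument
with x_f - x(delta(W,f)) gives |delta(W,f)| = 1.

Sufficiency: call two edges of a 2-edge-connected graph F equivalent if no 2-edge-connected
subgraph of F separates them, i.e. if they are equal or form a 2-edge cut of F. Subgraphs are
unions of classes, so it is enough that [a] vanishes on every class. If [a] vanishes on all
subgraphs containing a set X of edges, then it vanishes on each class D avoided by one of them:
let K be the largest subgraph containing X and avoiding D; the classes D' <> D outside K are
avoided by larger subgraphs than K (every edge leaving K lies in D), so a(D') = 0 inductively and
a(D) = a(F) - a(K) = 0. In case (i) all subgraphs containing [e2] (or [e1]) are tight, and X = {e2}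
finishes the proof. In case (ii), G consists of the maximal 2-edge-connected subgraphs L1, L2 of
the two sides through [e1], [e2], and of chains of 2-edge-connected subgraphs joining L1 to L2,
one for each edge of delta(S). For a set I of cut edges let K_I be G without the chains outside I.
For |I| = 2 the subgraphs of K_I containing [e1] and [e2] are tight, and X = {e1, e2} settles all
classes except some in L1, L2, for which tightness of the subgraphs of L1, L2 is used. For
|I| >= 3 each class off the chains is already a class of some K_{I - i}. The chains themselves
have a-weights that sum to zero pairwise, hence vanish.
*)

(** * Cuts and 2-edge-connected edge sets *)

Section Crossing.
Variable T : finType.
Implicit Types (A B C S W f g h c d x y z e : {set T}) (F G H K X : {set {set T}}).

Definition crosses A f := #|f :&: A| == 1.

Lemma edgeE f : #|f| = 2 -> exists u v, u != v /\ f = [set u; v].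
Proof. by move/eqP/cards2P => [u [v [uv ->]]]; exists u, v. Qed.

Lemma crosses2 A u v : u != v -> crosses A [set u; v] = (u \in A) (+) (v \in A).
Proof.
move=> uv; rewrite /crosses setIUl.
have E w : [set w] :&: A = if w \in A then [set w] else set0.
  case wA: (w \in A); apply/setP => z; rewrite !inE.
    by case: eqP => // ->; rewrite wA.
  by case: eqP => // ->; rewrite wA.
rewrite !E; case: (u \in A); case: (v \in A) => /=.
- by rewrite cards2 uv.
- by rewrite setU0 cards1.
- by rewrite set0U cards1.
- by rewrite setU0 cards0.
Qed.

Lemma subset2 A u v : ([set u; v] \subset A) = (u \in A) && (v \in A).
Proof. by rewrite subUset !sub1set. Qed.

Lemma crossesP S f : #|f| = 2 -> crosses S f ->
  exists u v, [/\ f = [set u; v], u \in S & v \notin S].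
Proof.
move=> /edgeE [u [v [uv ->]]]; rewrite crosses2 //.
case uS: (u \in S); case vS: (v \in S) => //= _.
  by exists u, v; rewrite uS vS.
by exists v, u; rewrite uS vS setUC.
Qed.

End Crossing.

Ltac edge_cases Hf :=
  have [? [? [? ->]]] := edgeE Hf;
  rewrite ?crosses2 // ?subset2 ?inE;
  do ?[case: (_ \in _) => //=].

Section TwoEdgeConnected.
Variable T : finType.
Implicit Types (A B C S W f g h c d x y z e : {set T}) (F G H K X : {set {set T}}).

Lemma crossesC A f : #|f| = 2 -> crosses (~: A) f = crosses A f.
Proof. by move=> Hf; edge_cases Hf. Qed.

Lemma ncrosses_side A f : #|f| = 2 -> ~~ crosses A f -> (f \subset A) || (f \subset ~: A).
Proof. by move=> Hf; edge_cases Hf. Qed.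

Lemma crosses_nsub A f : #|f| = 2 -> crosses A f -> ~~ (f \subset A).
Proof. by move=> Hf; edge_cases Hf. Qed.

Lemma crosses_nsubC A f : #|f| = 2 -> crosses A f -> ~~ (f \subset ~: A).
Proof. by move=> Hf; edge_cases Hf. Qed.

Lemma sub_ncrosses A f : #|f| = 2 -> f \subset A -> ~~ crosses A f.
Proof. by move=> Hf; edge_cases Hf. Qed.

Lemma subC_ncrosses A f : #|f| = 2 -> f \subset ~: A -> ~~ crosses A f.
Proof. by move=> Hf; edge_cases Hf. Qed.

Lemma sub_nsubC A f : #|f| = 2 -> f \subset A -> ~~ (f \subset ~: A).
Proof. by move=> Hf; edge_cases Hf. Qed.

Definition simple F := [forall f in F, #|f| == 2].

Lemma simpleP F : reflect (forall f, f \in F -> #|f| = 2) (simple F).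
Proof. by apply: (iffP forall_inP) => h f /h /eqP. Qed.

(* An edge set is 2-edge-connected when every set [A] separating two of its edges (or crossed
   by one) is crossed by at least two; "at least two" reads "for every [d] one different from
   [d]". Isolated vertices play no role, so only edges are recorded. *)
Definition tec F := simple F &&
  [forall A : {set T}, forall d : {set T}, forall x in F, forall y in F,
    (~~ (x \subset ~: A) && ~~ (y \subset A)) ==> [exists f in F, crosses A f && (f != d)]].

Lemma tecP F : simple F ->
  reflect (forall A d x y, x \in F -> y \in F -> ~~ (x \subset ~: A) -> ~~ (y \subset A) ->
     exists f, [/\ f \in F, crosses A f & f != d]) (tec F).
Proof.
move=> sF; rewrite /tec sF; apply: (iffP forallP) => [h A d x y xF yF xA yA|h A].
  move/forallP/(_ d)/forall_inP/(_ x xF)/forall_inP/(_ y yF): (h A).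
  by rewrite xA yA => /exists_inP [f fF /andP [fA fd]]; exists f.
apply/forallP => d; apply/forall_inP => x xF; apply/forall_inP => y yF.
apply/implyP => /andP [xA yA]; have [f [fF fA fd]] := h A d x y xF yF xA yA.
by apply/exists_inP; exists f => //; rewrite fA.
Qed.

Lemma tec_simple F : tec F -> simple F. Proof. by case/andP. Qed.

Lemma tec2 F f : tec F -> f \in F -> #|f| = 2.
Proof. by move/tec_simple/simpleP; apply. Qed.

Lemma tec_cross F A d x y : tec F -> x \in F -> y \in F -> ~~ (x \subset ~: A) ->
  ~~ (y \subset A) -> exists f, [/\ f \in F, crosses A f & f != d].
Proof. by move=> tF; move/(tecP (tec_simple tF)): (tF); apply. Qed.

Lemma tec_cross_other F A x : tec F -> x \in F -> crosses A x ->
  exists f, [/\ f \in F, crosses A f & f != x].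
Proof.
move=> tF xF xA; have x2 := tec2 tF xF.
by apply: (tec_cross x tF xF xF); [apply: crosses_nsubC | apply: crosses_nsub].
Qed.

Lemma tec_in F A x y : tec F -> (forall f, f \in F -> ~~ crosses A f) ->
  x \in F -> ~~ (x \subset ~: A) -> y \in F -> y \subset A.
Proof.
move=> tF nc xF xA yF; apply/negPn/negP => yA.
by have [f [fF fA _]] := tec_cross set0 tF xF yF xA yA; move: (nc f fF); rewrite fA.
Qed.

Lemma tec_out F A x y : tec F -> (forall f, f \in F -> ~~ crosses A f) ->
  x \in F -> ~~ (x \subset A) -> y \in F -> y \subset ~: A.
Proof.
move=> tF nc xF xA yF; apply: (@tec_in F (~: A) x) => //; last by rewrite setCK.
by move=> f fF; rewrite crossesC ?nc // (tec2 tF fF).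
Qed.

Lemma simpleS F G : F \subset G -> simple G -> simple F.
Proof. by move=> /subsetP FG /simpleP sG; apply/simpleP => f /FG /sG. Qed.

Lemma tec0 : tec set0.
Proof.
have s0 : simple set0 by apply/simpleP => f; rewrite inE.
by apply/tecP => // A d x y; rewrite inE.
Qed.

Lemma tecU F G x y v : tec F -> tec G -> x \in F -> y \in G -> v \in x -> v \in y ->
  tec (F :|: G).
Proof.
move=> tF tG xF yG vx vy.
have sFG : simple (F :|: G).
  by apply/simpleP => f; rewrite inE => /orP [] /tec2; apply.
apply/tecP => // A d p q; rewrite !inE.
have key F' p' q' : tec F' -> F' \subset F :|: G -> p' \in F' -> q' \in F' ->
    ~~ (p' \subset ~: A) -> ~~ (q' \subset A) ->
    exists f, [/\ f \in F :|: G, crosses A f & f != d].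
  move=> tF' sub pF qF pA qA; have [f [fF fA fd]] := tec_cross d tF' pF qF pA qA.
  by exists f; rewrite (subsetP sub).
have kF := key F _ _ tF (subsetUl _ _).
have kG := key G _ _ tG (subsetUr _ _).
move=> pFG qFG pA qA.
case vA: (v \in A).
  have xA : ~~ (x \subset ~: A) by apply/negP => /subsetP/(_ v vx); rewrite inE vA.
  have yA : ~~ (y \subset ~: A) by apply/negP => /subsetP/(_ v vy); rewrite inE vA.
  by case/orP: qFG => ?; [apply: (kF x q) | apply: (kG y q)].
have xA : ~~ (x \subset A) by apply/negP => /subsetP/(_ v vx); rewrite vA.
have yA : ~~ (y \subset A) by apply/negP => /subsetP/(_ v vy); rewrite vA.
by case/orP: pFG => ?; [apply: (kF p x) | apply: (kG p y)].
Qed.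

Lemma tecU1 F G x : tec F -> tec G -> x \in F -> x \in G -> tec (F :|: G).
Proof.
move=> tF tG xF xG; have [u [v [_ xE]]] := edgeE (tec2 tF xF).
by apply: (tecU tF tG xF xG (v := u)); rewrite xE !inE eqxx.
Qed.

(* A weak form of Menger's theorem; the case [x = y] says that a non-bridge lies in a
   2-edge-connected subgraph. *)
Lemma tec_or_bridge F x y : simple F -> x \in F -> y \in F ->
  (exists H, [/\ tec H, H \subset F, x \in H & y \in H]) \/
  (exists A d, [/\ forall f, f \in F -> crosses A f -> f = d,
                   ~~ (x \subset ~: A) & ~~ (y \subset A)]).
Proof.
have [n] := ubnP #|F|; elim: n => // n IHn in F x y *.
rewrite ltnS => leF sF xF yF.
case tF: (tec F); first by left; exists F.
have [A [d [p [q [pF qF pA qA cA]]]]] : exists A d p q,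
    [/\ p \in F, q \in F, ~~ (p \subset ~: A), ~~ (q \subset A) &
     forall f, f \in F -> crosses A f -> f = d].
  have [/existsP [A /existsP [d /exists_inP [p pF /exists_inP [q qF]]]]|nex] := boolP
    [exists A : {set T}, exists d : {set T}, exists p in F, exists q in F,
      [&& ~~ (p \subset ~: A), ~~ (q \subset A) & [forall f in F, crosses A f ==> (f == d)]]].
    case/and3P => pA qA /forall_inP h; exists A, d, p, q; split=> // f fF fA.
    by move: (h f fF); rewrite fA => /eqP.
  move/negP: tF; case; apply/tecP => // A d p q pF qF pA qA.
  have [/exists_inP [f fF /andP [fA fd]]|nf] := boolP [exists f in F, crosses A f && (f != d)].
    by exists f.
  case/negP: nex; apply/existsP; exists A; apply/existsP; exists d.
  apply/exists_inP; exists p => //; apply/exists_inP; exists q => //.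
  rewrite pA qA /=; apply/forall_inP => f fF; apply/implyP => fA.
  by apply: contraR nf => fd; apply/exists_inP; exists f; rewrite // fA.
have s2 := simpleP _ sF.
(* The case of [x] and [y] on the same side [B] of the cut: the induction hypothesis is applied to
   the edges inside [B], which are fewer because [z] leaves [B]. *)
have main B z : z \in F -> ~~ (z \subset B) -> (forall f, f \in F -> crosses B f -> f = d) ->
   x \subset B -> y \subset B ->
  (exists H, [/\ tec H, H \subset F, x \in H & y \in H]) \/
  (exists A d, [/\ forall f, f \in F -> crosses A f -> f = d,
                   ~~ (x \subset ~: A) & ~~ (y \subset A)]).
  move=> zF zB cB xB yB.
  set F' := [set f in F | f \subset B].
  have F'F : F' \subset F by apply/subsetP => f; rewrite inE => /andP [].
  have [||||[H [tH HF xH yH]]|[C [d' [cC xC yC]]]] := IHn F' x y.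
  - apply: leq_trans leF; apply: proper_card; rewrite properE F'F /=.
    by apply/subsetPn; exists z; rewrite // inE zF.
  - exact: simpleS F'F sF.
  - by rewrite inE xF.
  - by rewrite inE yF.
  - by left; exists H; split=> //; apply: subset_trans HF F'F.
  right.
  have cC' f : f \in F -> f \subset B -> crosses C f -> f = d'.
    by move=> fF fB; apply: cC; rewrite inE fF.
  (* Only [d] can leave [B]. Whether its end in [B] belongs to [C] decides if the complement of [B]
     is added to [C], so that [d] does not cross the extended set. *)
  have [/existsP [v /and3P [vd vB vC]]|/existsPn nv] :=
     boolP [exists v, [&& v \in d, v \in B & v \in C]].
    exists (C :|: ~: B), d'; split.
    - move=> f fF fCB; case fB: (crosses B f); last first.
        apply: cC' => //; last by move: fCB (negbT fB); edge_cases (s2 _ fF).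
        by move: fCB (negbT fB); edge_cases (s2 _ fF).
      have fd := cB _ fF fB; subst f.
      have [a [b [dE aB bB]]] := crossesP (s2 _ fF) fB.
      move: fCB; have ab : a != b by apply: contraNneq bB => <-.
      rewrite dE crosses2 // !inE aB bB orbT addbT orbF.
      have <- : v = a by move: vd; rewrite dE !inE => /orP [/eqP //|/eqP vb]; rewrite -vb vB in bB.
      by rewrite vC.
    - apply: contra xC => /subsetP h; apply/subsetP => w wx; move: (h w wx).
      by rewrite !inE negb_or => /andP [].
    - apply: contra yC => /subsetP h; apply/subsetP => w wy; move: (h w wy).
      by rewrite !inE (subsetP yB _ wy) orbF.
  exists (C :&: B), d'; split.
  - move=> f fF fCB; case fB: (crosses B f); last first.
      apply: cC' => //; last by move: fCB (negbT fB); edge_cases (s2 _ fF).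
      by move: fCB (negbT fB); edge_cases (s2 _ fF).
    have fd := cB _ fF fB; subst f.
    have [a [b [dE aB bB]]] := crossesP (s2 _ fF) fB.
    move: fCB; have ab : a != b by apply: contraNneq bB => <-.
    rewrite dE crosses2 // !inE aB (negbTE bB) andbT andbF addbF => aC.
    by move: (nv a); rewrite dE !inE eqxx aB aC.
  - apply: contra xC => /subsetP h; apply/subsetP => w wx; move: (h w wx).
    by rewrite !inE (subsetP xB _ wx) andbT.
  - by apply: contra yC => /subsetP h; apply/subsetP => w /h; rewrite inE => /andP [].
have [/andP [xA yA]|] := boolP (~~ (x \subset ~: A) && ~~ (y \subset A)).
  by right; exists A, d.
rewrite negb_and !negbK => xyA.
have [/andP [yA xA]|] := boolP (~~ (y \subset ~: A) && ~~ (x \subset A)).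
  right; exists (~: A), d; rewrite setCK; split=> // f fF.
  by rewrite crossesC ?s2 //; apply: cA.
rewrite negb_and !negbK => yxA.
have xn := sub_nsubC (s2 _ xF) (A := A); have yn := sub_nsubC (s2 _ yF) (A := A).
case xA: (x \subset A) in xyA yxA xn.
  have yA : y \subset A by move: xyA; rewrite (negbTE (xn isT)).
  exact: (main A q).
rewrite orbF in yxA.
have {}xyA : x \subset ~: A by case/orP: xyA => // /yn; rewrite yxA.
apply: (main (~: A) p) => //; move=> f fF; rewrite crossesC ?s2 //; exact: cA.
Qed.

End TwoEdgeConnected.

(** * Series classes and weights *)

Section Classes.
Variable T : finType.
Implicit Types (A B C S W f g h c d x y z e : {set T}) (F G H K X Y Z : {set {set T}}).

Lemma tec_or_bridge1 F x : simple F -> x \in F ->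
  (exists H, [/\ tec H, H \subset F & x \in H]) \/
  (exists A, crosses A x /\ forall f, f \in F -> crosses A f -> f = x).
Proof.
move=> sF xF; have [[H [tH HF xH _]]|[A [d [cA xA1 xA2]]]] := tec_or_bridge sF xF xF.
  by left; exists H.
have xA : crosses A x.
  by apply: contraR xA2 => /(ncrosses_side (simpleP _ sF _ xF)); rewrite (negbTE xA1) orbF.
by right; exists A; split=> // f fF fA; rewrite (cA f) // (cA x).
Qed.

(* For [tec F] this means [c = f] or [{c, f}] is a 2-edge cut of [F]: [cut_eqv], [eqv_or_sep]. *)
Definition eqv F c f := [forall H : {set {set T}}, tec H && (H \subset F) ==> ((c \in H) == (f \in H))].

Lemma eqvP F c f : reflect (forall H, tec H -> H \subset F -> (c \in H) = (f \in H)) (eqv F c f).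
Proof.
apply: (iffP forallP) => [h H tH HF|h H].
  by apply/eqP; apply: (implyP (h H)); rewrite tH.
by apply/implyP => /andP [tH HF]; rewrite (h H).
Qed.

Lemma eqv_refl F c : eqv F c c. Proof. by apply/eqvP. Qed.

Lemma eqv_sym F c f : eqv F c f = eqv F f c.
Proof. by apply/eqvP/eqvP => h H tH HF; rewrite h. Qed.

Lemma eqv_trans F c d f : eqv F c d -> eqv F d f -> eqv F c f.
Proof. by move=> /eqvP h1 /eqvP h2; apply/eqvP => H tH HF; rewrite h1 // h2. Qed.

Lemma eqv_sub F G c f : G \subset F -> eqv F c f -> eqv G c f.
Proof. by move=> GF /eqvP h; apply/eqvP => H tH HG; apply: h (subset_trans HG GF). Qed.

Lemma eqv_mem F G c f : eqv F c f -> tec G -> G \subset F -> c \in G -> f \in G.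
Proof. by move=> /eqvP h tG GF; rewrite h. Qed.

(** A 2-edge-connected subgraph containing one of the two edges crosses [A] a second time, and only
    the other edge can do so. *)
Lemma cut_eqv F A c d : crosses A c -> crosses A d ->
  (forall f, f \in F -> crosses A f -> f = c \/ f = d) -> eqv F c d.
Proof.
have half c' d' : crosses A c' -> (forall f, f \in F -> crosses A f -> f = c' \/ f = d') ->
    forall H, tec H -> H \subset F -> c' \in H -> d' \in H.
  move=> cA h H tH HF cH; have [f [fH fA fc]] := tec_cross_other tH cH cA.
  by case: (h f (subsetP HF _ fH) fA) => E; [rewrite E eqxx in fc | rewrite -E].
move=> cA dA h; apply/eqvP => H tH HF; apply/idP/idP; first exact: (half c d).
by apply: (half d c) => // f fF fA; case: (h f fF fA); [right | left].
Qed.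

(** Apply [tec_or_bridge1] to [x] in [F] minus [c]. If [x] is a bridge there, its cut must be
    crossed in [F] by [c] as well, so [c] and [x] form a 2-edge cut. *)
Lemma eqv_or_sep F c x : tec F -> c \in F -> x \in F ->
  eqv F c x \/ exists H, [/\ tec H, H \subset F, x \in H & c \notin H].
Proof.
move=> tF cF xF; case: (eqVneq x c) => [->|xc]; first by left; apply: eqv_refl.
have sFc : simple (F :\ c) by apply: simpleS (tec_simple tF); apply: subD1set.
have xFc : x \in F :\ c by rewrite !inE xc.
have [[H [tH HF xH]]|[A [xA cA]]] := tec_or_bridge1 sFc xFc.
  right; exists H; split=> //; first exact: subset_trans HF (subD1set _ _).
  by apply/negP => /(subsetP HF); rewrite !inE eqxx.
left; have h f : f \in F -> crosses A f -> f = x \/ f = c.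
  move=> fF fA; case: (eqVneq f c) => [->|fc]; [by right|left].
  by apply: cA => //; rewrite !inE fc.
rewrite eqv_sym; apply: (cut_eqv xA _ h).
have [f [fF fA fx]] := tec_cross_other tF xF xA.
by case: (h f fF fA) => E; [rewrite E eqxx in fx | rewrite -E].
Qed.

Definition cls F c := [set f in F | eqv F c f].

Lemma mem_cls F c : c \in F -> c \in cls F c.
Proof. by move=> cF; rewrite inE cF eqv_refl. Qed.

Lemma cls_sub F c : cls F c \subset F.
Proof. by apply/subsetP => f; rewrite inE => /andP []. Qed.

Lemma eq_cls F c f : eqv F c f -> cls F c = cls F f.
Proof.
move=> cf; apply/setP => x; rewrite !inE; case: (x \in F) => //=.
by apply/idP/idP; apply: eqv_trans; rewrite // eqv_sym.
Qed.


(** The unions of series classes of [F]. *)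
Definition closed_cls F Y :=
  Y \subset F /\ forall f x, f \in Y -> x \in F -> eqv F f x -> x \in Y.

Lemma tec_closed F H : tec H -> H \subset F -> closed_cls F H.
Proof. by move=> tH HF; split=> // f x fH _ fx; apply: eqv_mem fx tH HF fH. Qed.

Lemma closedD F Y c : closed_cls F Y -> closed_cls F (Y :\: cls F c).
Proof.
move=> [YF cY]; split=> [|f x]; first exact: subset_trans (subsetDl _ _) YF.
rewrite !inE => /andP [fc fY] xF fx; rewrite (cY f) // andbT.
apply: contra fc => /andP [_ cx]; rewrite (subsetP YF) //=.
by apply: eqv_trans cx _; rewrite eqv_sym.
Qed.

Lemma cls_sub_closed F Y c : closed_cls F Y -> c \in Y -> cls F c \subset Y.
Proof. by move=> [_ cY] cI; apply/subsetP => x; rewrite inE => /andP [xF cx]; apply: cY cx. Qed.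

Section Sums.
Variables (V : zmodType) (a : {set T} -> V).
Local Open Scope ring_scope.

Definition wt (Y : {set {set T}}) : V := \sum_(f in Y) a f.

Lemma wtD Y Z : Z \subset Y -> wt Y = wt Z + wt (Y :\: Z).
Proof. by move=> ZY; rewrite /wt (big_setID Z) /= (setIidPr ZY). Qed.

Lemma wt_closed0 F Y : closed_cls F Y ->
  (forall f, f \in Y -> wt (cls F f) = 0) -> wt Y = 0.
Proof.
have [n] := ubnP #|Y|; elim: n => // n IHn in Y *; rewrite ltnS => leY cY h.
have [->|[f fY]] := set_0Vmem Y; first by rewrite /wt big_set0.
rewrite (wtD (cls_sub_closed cY fY)) h // add0r; apply: IHn.
- apply: leq_trans leY; apply: proper_card; rewrite properE subsetDl /=.
  apply/subsetPn; exists f; rewrite // inE mem_cls //.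
  by case: cY => YF _; apply: (subsetP YF).
- exact: closedD.
- by move=> x; rewrite inE => /andP [_ /h].
Qed.

Lemma wt_closed1 F Y c : closed_cls F Y -> c \in Y ->
  (forall f, f \in Y -> ~~ eqv F c f -> wt (cls F f) = 0) -> wt Y = wt (cls F c).
Proof.
move=> cY cI h; rewrite (wtD (cls_sub_closed cY cI)) [X in _ + X](wt_closed0 (F := F)) ?addr0 //.
  exact: closedD.
move=> f; rewrite 2!inE negb_and => /andP [H fY]; apply: h => //.
by case: cY => YF _; move: H; rewrite (subsetP YF).
Qed.

End Sums.

(* A union of edge sets sharing [X], hence itself 2-edge-connected when [X] is nonempty. *)
Definition mtec F X := \bigcup_(H : {set {set T}} | [&& tec H, X \subset H & H \subset F]) H.

Lemma mtec_sub F X : mtec F X \subset F.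
Proof. by apply/bigcupsP => H /and3P []. Qed.

Lemma mtec_max F X H : tec H -> X \subset H -> H \subset F -> H \subset mtec F X.
Proof. by move=> tH XH HF; apply: bigcup_sup; rewrite tH XH. Qed.

Lemma mtec_tec F X e : e \in X -> tec (mtec F X).
Proof.
move=> eX; rewrite /mtec.
suff : tec (mtec F X) /\ (mtec F X = set0 \/ e \in mtec F X) by case.
rewrite /mtec; elim/big_rec: _ => [|H K /and3P [tH XH HF] [tK eK]].
  by split; [apply: tec0 | left].
have eH := subsetP XH _ eX; split; last by right; rewrite inE eH.
case: eK => [->|eK]; first by rewrite setU0.
exact: tecU1 tH tK eH eK.
Qed.

(** The union with [H] is again a candidate in the definition of [mtec]; [X \subset mtec F X]
    excludes the case of no candidate at all. *)
Lemma mtec_join F X e H y z v : e \in X -> tec H -> H \subset F -> X \subset mtec F X ->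
  y \in H -> z \in mtec F X -> v \in y -> v \in z -> H \subset mtec F X.
Proof.
move=> eX tH HF XK yH zK vy vz.
apply: subset_trans (subsetUl H (mtec F X)) (mtec_max _ _ _).
- exact: tecU tH (mtec_tec _ eX) yH zK vy vz.
- exact: subset_trans XK (subsetUr _ _).
- by rewrite subUset HF mtec_sub.
Qed.

Lemma mtec_join1 F X e H y : e \in X -> tec H -> H \subset F -> X \subset mtec F X ->
  y \in H -> y \in mtec F X -> H \subset mtec F X.
Proof.
move=> eX tH HF XK yH yK; have [u [v [_ yE]]] := edgeE (tec2 tH yH).
by apply: (@mtec_join F X e H y y u) => //; rewrite yE !inE eqxx.
Qed.

(** * Functionals vanishing on the subgraphs that contain a given set *)

Section VanishingWeights.
Variables (V : zmodType) (a : {set T} -> V).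
Local Open Scope ring_scope.

(** Both [F] and [K c] contain [X], so [a] vanishes on [F :\: K c]; by induction on the size of this
    difference, all classes in it other than that of [c] have weight zero. *)
Lemma wt_cls_eq0 F X e c : tec F -> e \in X -> X \subset F ->
  (forall H, tec H -> X \subset H -> H \subset F -> wt a H = 0) -> c \in F ->
  (exists H, [/\ tec H, X \subset H, H \subset F & c \notin H]) -> wt a (cls F c) = 0.
Proof.
move=> tF eX XF a0.
pose K c := mtec (F :\ c) X.
have [n] := ubnP #|F :\: K c|; elim: n => // n IHn in c *; rewrite ltnS => len cF.
case=> H [tH XH HF cH].
have HK : H \subset K c by apply: mtec_max; rewrite // subsetD1 HF.
have XK : X \subset K c := subset_trans XH HK.
have tK : tec (K c) := mtec_tec _ eX.
have KFc : K c \subset F :\ c := mtec_sub _ _.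
have KF : K c \subset F := subset_trans KFc (subD1set _ _).
have cK : c \notin K c by apply/negP => /(subsetP KFc); rewrite !inE eqxx.
have clD : closed_cls F (F :\: K c).
  split=> [|f x]; first exact: subsetDl.
  rewrite !inE => /andP [fK _] -> fx; rewrite andbT.
  by apply: contra fK; apply: eqv_mem tK KF; rewrite eqv_sym.
have clF := tec_closed tF (subxx F).
have -> : wt a (cls F c) = wt a (F :\: K c).
  symmetry; apply: wt_closed1 => //; first by rewrite inE cK.
  move=> f; rewrite inE => /andP [fK fF] ncf.
  apply: IHn => //; last by exists (K c).
  apply: leq_trans len; apply: proper_card.
  have KK : K c \subset K f by apply: mtec_max => //; rewrite subsetD1 KF.
  rewrite properE setDS //=.
  (* An edge outside [K c] that touches [K c]: [c] itself if both its ends are covered, otherwise an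
     edge of [F] leaving the covered vertex set. *)
  have [x [xF xK [y [v [yK vx vy]]]]] : exists x, [/\ x \in F, x \notin K c &
      exists y v, [/\ y \in K c, v \in x & v \in y]].
    have eK := subsetP XK _ eX; pose A := cover (K c).
    have KA y : y \in K c -> y \subset A by move=> yK; apply: (bigcup_sup y).
    have [cA|cA] := boolP (c \subset A).
      have [u [v [_ cE]]] := edgeE (tec2 tF cF).
      have /(subsetP cA)/bigcupP [y yK uy] : u \in c by rewrite cE !inE eqxx.
      by exists c; split=> //; exists y, u; split=> //; rewrite cE !inE eqxx.
    have eA : ~~ (e \subset ~: A).
      by apply: sub_nsubC (KA _ eK); apply: tec2 tK eK.
    have [x [xF xA _]] := tec_cross set0 tF (subsetP XF _ eX) cF eA cA.
    have x2 := tec2 tF xF.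
    exists x; split=> //.
      by apply: contraL xA => /KA xA; apply: sub_ncrosses.
    have [u [v [-> /bigcupP [y yK uy] _]]] := crossesP x2 xA.
    by exists y, u; rewrite !inE eqxx.
  (* Otherwise a subgraph through [x] avoiding [c] could be added to [K c]. *)
  have cx : eqv F c x.
    have [//|[H' [tH' HF' xH' cH']]] := eqv_or_sep tF cF xF.
    case/negP: xK; apply: (subsetP (mtec_join eX tH' _ XK xH' yK vx vy)) => //.
    by rewrite subsetD1 HF'.
  (* As [f] is not equivalent to [x], [K f] absorbs a subgraph through [x] and is strictly larger
     than [K c]. *)
  have [fx|[H' [tH' HF' xH' fH']]] := eqv_or_sep tF fF xF.
    by case/negP: ncf; apply: eqv_trans cx _; rewrite eqv_sym.
  apply/subsetPn; exists x; rewrite inE xF ?xK // andbT negbK.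
  apply: (subsetP (mtec_join eX tH' _ (subset_trans XK KK) xH' (subsetP KK _ yK) vx vy)) => //.
  by rewrite subsetD1 HF'.
by move: (a0 F tF XF (subxx F)); rewrite (wtD a KF) (a0 _ tK XK KF) add0r.
Qed.

(** Every class other than that of [e] is avoided by a subgraph through [e], so [wt_cls_eq0] applies
    to it; the class of [e] is what remains of [F]. *)
Lemma wt_cls_eq0_edge F e : tec F -> e \in F ->
  (forall H, tec H -> e \in H -> H \subset F -> wt a H = 0) ->
  forall c, c \in F -> wt a (cls F c) = 0.
Proof.
move=> tF eF a0.
have other c : c \in F -> ~~ eqv F e c -> wt a (cls F c) = 0.
  move=> cF nec; have [ce|[H [tH HF eH cH]]] := eqv_or_sep tF cF eF.
    by rewrite eqv_sym ce in nec.
  apply: (@wt_cls_eq0 F [set e] e) => //; rewrite ?inE ?sub1set //.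
    by move=> H' tH'; rewrite sub1set; apply: a0.
  by exists H; rewrite sub1set.
move=> c cF; have [ec|] := boolP (eqv F e c); last exact: other.
rewrite -(eq_cls ec) -(wt_closed1 (tec_closed tF (subxx F)) eF other).
exact: a0.
Qed.

Lemma wt_tec_eq0 F : (forall c, c \in F -> wt a (cls F c) = 0) ->
  forall H, tec H -> H \subset F -> wt a H = 0.
Proof.
move=> h H tH HF; apply: wt_closed0 (tec_closed tH HF) _ => f fH.
exact: h (subsetP HF _ fH).
Qed.

End VanishingWeights.
End Classes.

(** * The two shores of the cut *)

Section Sides.
Variable T : finType.
Implicit Types (A B C S W f g h c d i j x y z e : {set T}) (E F G H K X Y Z I J : {set {set T}}).

(** Connectedness of G[S], stated through cuts to match [tec]. *)
Definition conn E S := forall A,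
  (forall f, f \in E -> f \subset S -> ~~ crosses A f) -> S \subset A \/ S \subset ~: A.

(* The hypotheses of case (ii) on one shore: G[S] is connected, [e] is not a bridge of it, and at
   most one cut edge leaves the part [A] that a bridge [f] of G[S] separates from [e]. *)
Definition side E S e := [/\ e \in E, e \subset S, conn E S,
  forall A, crosses A e -> exists f, [/\ f \in E, f \subset S, crosses A f & f != e] &
  forall A f, A \subset S -> f \in E -> f \subset S -> crosses A f ->
    (forall f', f' \in E -> f' \subset S -> crosses A f' -> f' = f) -> e \subset ~: A ->
    forall g h, g \in E -> h \in E -> crosses S g -> crosses S h ->
      ~~ (g \subset ~: A) -> ~~ (h \subset ~: A) -> g = h].

(** The subgraph L1 of the overview, or L2 when taken on the complementary shore. *)
Definition core E S e := mtec [set f in E | f \subset S] [set e].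

Lemma core_tec E S e : tec (core E S e).
Proof. by apply: (mtec_tec _ (e := e)); rewrite inE. Qed.

Lemma core_sub E S e f : f \in core E S e -> f \in E /\ f \subset S.
Proof. by move/(subsetP (mtec_sub _ _)); rewrite inE => /andP. Qed.

Lemma core_subE E S e : core E S e \subset E.
Proof. by apply/subsetP => f /core_sub []. Qed.

Lemma core_mem E S e : tec E -> side E S e -> e \in core E S e.
Proof.
move=> tE [eE eS _ nb _].
have s : simple [set f in E | f \subset S].
  by apply: simpleS (tec_simple tE); apply/subsetP => f; rewrite inE => /andP [].
have ei : e \in [set f in E | f \subset S] by rewrite inE eE.
have [[H [tH HF eH]]|[A [eA cA]]] := tec_or_bridge1 s ei.
  by apply: (subsetP (mtec_max tH _ HF)); rewrite ?sub1set.
have [f [fE fS fA fe]] := nb A eA.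
by rewrite (cA f) ?inE ?fE ?eqxx in fe.
Qed.

Lemma core_join E S e H c : tec E -> side E S e -> tec H -> H \subset E ->
  (forall f, f \in H -> f \subset S) -> c \in H -> c \in core E S e -> H \subset core E S e.
Proof.
move=> tE sd tH HE HS cH cL; apply: (@mtec_join1 _ _ [set e] e _ c) => //.
- by rewrite inE.
- by apply/subsetP => f fH; rewrite inE (subsetP HE) // HS.
- by rewrite sub1set core_mem.
Qed.

(** By [tec_or_bridge] a bridge [f] of G[S] separates [c] from [e]. The part [B] behind it has at
    most one cut edge by [side], and at least one since [f] is not a bridge of G; so [f] and [g]
    form a 2-edge cut of G around [B]. *)
Lemma pendant E S e c : tec E -> side E S e -> c \in E -> c \subset S -> c \notin core E S e ->
  exists B f g, [/\ [/\ B \subset S, ~~ (c \subset ~: B) & e \subset ~: B],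
    [/\ f \in E, f \subset S & crosses B f],
    [/\ g \in E, crosses S g & crosses B g] &
    forall y, y \in E -> crosses B y -> y = f \/ y = g].
Proof.
move=> tE sd cE cS cL; case: (sd) => eE eS cn nb br.
have E2 f : f \in E -> #|f| = 2 by apply: tec2.
have s : simple [set f in E | f \subset S].
  by apply: simpleS (tec_simple tE); apply/subsetP => f; rewrite inE => /andP [].
have ei : e \in [set f in E | f \subset S] by rewrite inE eE.
have ci : c \in [set f in E | f \subset S] by rewrite inE cE.
have [[H [tH HF cH eH]]|[B' [f [cB' cB eB]]]] := tec_or_bridge s ci ei.
  by case/negP: cL; apply: (subsetP (mtec_max tH _ HF)); rewrite ?sub1set.
have {}cB' y : y \in E -> y \subset S -> crosses B' y -> y = f.
  by move=> yE yS; apply: cB'; rewrite inE yE.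
(* Connectedness of G[S] ensures that some edge inside [S] does cross [B']. *)
have [/exists_inP [f0 f0E /andP [f0S f0B]]|nf] := boolP [exists f in E, (f \subset S) && crosses B' f]; last first.
  have [y yE yS||] := cn B'.
  - by apply: contra nf => yB; apply/exists_inP; exists y; rewrite // yS.
  - by move=> SB; rewrite (subset_trans eS SB) in eB.
  - by move=> SB; rewrite (subset_trans cS SB) in cB.
have ff := cB' _ f0E f0S f0B; subst f0.
have eB' : e \subset ~: B'.
  have [eB1|/(ncrosses_side (E2 _ eE))] := boolP (crosses B' e); last by rewrite (negbTE eB).
  have [y [yE yS yB /eqP []]] := nb _ eB1; by rewrite (cB' _ yE yS yB) (cB' _ eE eS eB1).
pose B := B' :&: S.
have BS : B \subset S by apply: subsetIr.
have BE y : y \in E -> y \subset S -> crosses B y = crosses B' y.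
  move=> yE yS; congr (_ == _); congr #|pred_of_set _|; apply/setP => v; rewrite !inE.
  by case vy: (v \in y) => //=; rewrite (subsetP yS) // andbT.
have fB : crosses B f by rewrite BE.
have eBB : e \subset ~: B by apply: subset_trans eB' _; rewrite setCS subsetIl.
have cBB : ~~ (c \subset ~: B).
  apply: contra cB => /subsetP h; apply/subsetP => v vc; move: (h v vc).
  by rewrite !inE (subsetP cS _ vc) andbT.
have [g [gE gB gf]] := tec_cross_other tE f0E fB.
have nS y : y \in E -> crosses B y -> y != f -> crosses S y.
  move=> yE yB yf; apply: contraNT yf => /(ncrosses_side (E2 _ yE)) /orP [yS|yS].
    by apply/eqP; apply: cB' => //; rewrite -BE.
  by move: yB; rewrite (negbTE (subC_ncrosses (E2 _ yE) _)) // (subset_trans yS) // setCS.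
exists B, f, g; split=> //; first by split=> //; apply: nS.
move=> y yE yB; case: (eqVneq y f) => [->|yf]; [by left | right].
apply: (br B f) => //.
- by move=> f' f'E f'S; rewrite BE //; apply: cB'.
- exact: nS.
- exact: nS.
- exact: crosses_nsubC (E2 _ yE) yB.
- exact: crosses_nsubC (E2 _ gE) gB.
Qed.

Definition cutI E S I := [set f in E | crosses S f ==> (f \in I)].

Lemma cutIP E S I f : f \in E -> (crosses S f -> f \in I) -> f \in cutI E S I.
Proof. by move=> fE h; rewrite inE fE; apply/implyP. Qed.

Lemma cutI_sub E S I : cutI E S I \subset E.
Proof. by apply/subsetP => f; rewrite inE => /andP []. Qed.

Lemma cutI_cross E S I f : f \in cutI E S I -> crosses S f -> f \in I.
Proof. by rewrite inE => /andP [_ /implyP]. Qed.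

Lemma cutIS E S I J : I \subset J -> cutI E S I \subset cutI E S J.
Proof.
move=> IJ; apply/subsetP => f; rewrite !inE => /andP [-> /implyP h] /=.
by apply/implyP => /h /(subsetP IJ).
Qed.

Lemma cutIC E S I : tec E -> cutI E (~: S) I = cutI E S I.
Proof.
move=> tE; apply/setP => f; rewrite !inE; case fE: (f \in E) => //=.
by rewrite crossesC // (tec2 tE fE).
Qed.

(** Otherwise at most one edge [d] of [F] crosses a set [A] separating [g] from [e1]. If [d] lies
    inside [S], the connected opposite shore puts [h] on the side of [g], and the bridge [d] of G[S]
    separates two cut edges from [e1], against [side]. If not, neither shore is split by [A], so [d]
    is [g], and [h] would cross [A] as well. *)
Lemma pair_half E S e1 g h : tec E -> side E S e1 -> conn E (~: S) ->
  g \in E -> h \in E -> crosses S g -> crosses S h -> g != h ->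
  exists H, [/\ tec H, H \subset cutI E S [set g; h], g \in H & e1 \in H].
Proof.
move=> tE [eE eS cn nb br] cn' gE hE gS hS gh.
have E2 f : f \in E -> #|f| = 2 by apply: tec2.
set F := cutI E S [set g; h].
have sF : simple F by apply: simpleS (cutI_sub _ _ _) (tec_simple tE).
have inS f : f \in E -> f \subset S -> f \in F.
  by move=> fE fS; apply: cutIP => // fS'; rewrite (negbTE (sub_ncrosses (E2 _ fE) fS)) in fS'.
have inSC f : f \in E -> f \subset ~: S -> f \in F.
  by move=> fE fS; apply: cutIP => // fS'; rewrite (negbTE (subC_ncrosses (E2 _ fE) fS)) in fS'.
have gF : g \in F by apply: cutIP; rewrite // !inE eqxx.
have hF : h \in F by apply: cutIP; rewrite // !inE eqxx orbT.
have [[H [tH HF gH eH]]|[A [d [cA gA eA]]]] := tec_or_bridge sF gF (inS _ eE eS).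
  by exists H.
exfalso.
have [u [v [gE' uS vS]]] := crossesP (E2 _ gE) gS.
have [u' [v' [hE' uS' vS']]] := crossesP (E2 _ hE) hS.
have nSC f : f \in E -> f \subset ~: S -> ~~ (f \subset S).
  by move=> fE fS; apply: contraL fS; apply: sub_nsubC; apply: E2.
have [/exists_inP [f fE /andP [fS fA]]|nf] := boolP [exists f in E, (f \subset S) && crosses A f].
  have fd := cA _ (inS _ fE fS) fA; subst d.
  have gnA : ~~ crosses A g.
    by apply: contraL fS => /(cA _ gF) <-; apply: crosses_nsub (E2 _ gE) gS.
  have hnA : ~~ crosses A h.
    by apply: contraL fS => /(cA _ hF) <-; apply: crosses_nsub (E2 _ hE) hS.
  have gA' : g \subset A by move: (ncrosses_side (E2 _ gE) gnA); rewrite (negbTE gA) orbF.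
  have [y yE yS||SA] := cn' A.
  - by apply: contraL fS => /(cA _ (inSC _ yE yS)) <-; apply: nSC.
  - move=> SA.
    have hA : h \subset A.
      case/orP: (ncrosses_side (E2 _ hE) hnA) => // /subsetP /(_ v').
      by rewrite hE' !inE eqxx orbT (subsetP SA) ?inE // => /(_ isT).
    have eA' : e1 \subset ~: A.
      have [eA1|/(ncrosses_side (E2 _ eE))] := boolP (crosses A e1); last by rewrite (negbTE eA).
      have [y [yE yS yA /eqP []]] := nb _ eA1.
      by rewrite (cA _ (inS _ yE yS) yA) (cA _ (inS _ eE eS) eA1).
    have AE y : y \in E -> y \subset S -> crosses (A :&: S) y = crosses A y.
      move=> yE yS; congr (_ == _); congr #|pred_of_set _|; apply/setP => w; rewrite !inE.
      by case wy: (w \in y) => //=; rewrite (subsetP yS) // andbT.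
    case/eqP: gh; apply: (br (A :&: S) f) => //.
    + exact: subsetIr.
    + by rewrite AE.
    + by move=> y yE yS; rewrite AE //; apply: cA; apply: inS.
    + by apply: subset_trans eA' _; rewrite setCS subsetIl.
    + by move: gA' gS; edge_cases (E2 _ gE).
    + by move: hA hS; edge_cases (E2 _ hE).
  - by move: (subsetP SA v); rewrite !inE vS (subsetP gA') ?gE' ?inE ?eqxx ?orbT // => /(_ isT).
have [y yE yS|SA|SA] := cn A.
- by apply: contra nf => yA; apply/exists_inP; exists y; rewrite // yS.
- by rewrite (subset_trans eS SA) in eA.
have gd : crosses A g.
  apply: contraR gA => /(ncrosses_side (E2 _ gE)) /orP [] // /subsetP /(_ u).
  by rewrite gE' !inE eqxx => /(_ isT) uA; move: (subsetP SA _ uS); rewrite inE uA.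
have gdE := cA _ gF gd.
have [y yE yS|SA'|SA'] := cn' A.
- apply/negP => /(cA _ (inSC _ yE yS)) yd; move: (subC_ncrosses (E2 _ yE) yS).
  by rewrite yd -gdE gS.
- case/eqP: gh; rewrite gdE; symmetry; apply: (cA _ hF).
  have uA : u' \notin A by move: (subsetP SA _ uS'); rewrite inE.
  have vA : v' \in A by apply: (subsetP SA'); rewrite inE.
  by rewrite hE' crosses2 ?(negbTE uA) ?vA //; apply: contraNneq uA => ->.
- case/negP: gA; rewrite gE' subset2 (subsetP SA _ uS) (subsetP SA') ?inE //.
Qed.

Lemma pair_tec E S e1 e2 g h : tec E -> side E S e1 -> side E (~: S) e2 ->
  g \in E -> h \in E -> crosses S g -> crosses S h -> g != h ->
  exists H, [/\ tec H, H \subset cutI E S [set g; h], g \in H, e1 \in H & e2 \in H].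
Proof.
move=> tE sd1 sd2 gE hE gS hS gh; case: (sd1) (sd2) => [_ _ c1 _ _] [_ _ c2 _ _].
have [H [tH HF gH eH]] := pair_half tE sd1 c2 gE hE gS hS gh.
have [|||H' [tH' HF' gH' eH']] := pair_half tE sd2 _ gE hE _ _ gh.
- by rewrite setCK.
- by rewrite crossesC // (tec2 tE gE).
- by rewrite crossesC // (tec2 tE hE).
rewrite cutIC // in HF'.
exists (H :|: H'); rewrite !inE gH eH eH' orbT subUset HF HF'; split=> //.
exact: tecU1 tH tH' gH gH'.
Qed.

End Sides.

(** * Subgraphs with exactly two cut edges *)

Section Pairs.
Variable T : finType.
Implicit Types (A B C S W f g h c d i j x y z e : {set T}) (E F G H K M N X Y Z I J : {set {set T}}).

Lemma two_cut F A c d x y : tec F -> x \in F -> y \in F -> ~~ (x \subset ~: A) ->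
  ~~ (y \subset A) -> (forall z, z \in F :\ c -> crosses A z -> z = d) ->
  [/\ c \in F, d \in F, crosses A c, crosses A d & eqv F c d].
Proof.
move=> tF xF yF xA yA h.
have h' z : z \in F -> crosses A z -> z = c \/ z = d.
  move=> zF zA; case: (eqVneq z c) => [|zc]; [by left|right].
  by apply: h; rewrite // !inE zc.
have [z [zF zA zd]] := tec_cross d tF xF yF xA yA.
have [w [wF wA wc]] := tec_cross c tF xF yF xA yA.
have zc : z = c by case: (h' _ zF zA) => // E; rewrite E eqxx in zd.
have wd : w = d by case: (h' _ wF wA) => // E; rewrite E eqxx in wc.
by subst z w; split=> //; apply: cut_eqv h'.
Qed.

(** The alternative of [tec_or_bridge] in [F] minus [c]: a bridge [d] found there forms a 2-edge cut
    of [F] together with [c]. *)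
Lemma tec_or_two_cut F c x y : tec F -> x \in F -> y \in F -> x != c -> y != c ->
  (exists H, [/\ tec H, H \subset F, x \in H, y \in H & c \notin H]) \/
  (exists A d, [/\ ~~ (x \subset ~: A), ~~ (y \subset A) & 
     [/\ c \in F, d \in F, crosses A c, crosses A d & eqv F c d] /\
     forall z, z \in F -> crosses A z -> z = c \/ z = d]).
Proof.
move=> tF xF yF xc yc.
have sFc : simple (F :\ c) by apply: simpleS (tec_simple tF); apply: subD1set.
have xFc : x \in F :\ c by rewrite !inE xc.
have yFc : y \in F :\ c by rewrite !inE yc.
have [[H [tH HF xH yH]]|[A [d [cA xA yA]]]] := tec_or_bridge sFc xFc yFc.
  by left; exists H; move: HF; rewrite subsetD1 => /andP [].
right; exists A, d; split=> //; split; first exact: (two_cut tF xF yF).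
move=> z zF zA; case: (eqVneq z c) => [|zc]; [by left|right].
by apply: cA; rewrite // !inE zc.
Qed.

Lemma tec_cap_other E F B f g x y : tec F -> F \subset E -> x \in F -> y \in F ->
  ~~ (x \subset ~: B) -> ~~ (y \subset B) ->
  (forall z, z \in E -> crosses B z -> z = f \/ z = g) -> 
  [/\ f \in F, g \in F & eqv F f g].
Proof.
move=> tF FE xF yF xB yB h.
have [|fF gF fB gB fg] := @two_cut F B f g x y tF xF yF xB yB; last by [].
move=> z; rewrite !inE => /andP [zf zF] zB.
by case: (h z (subsetP FE _ zF) zB) => // E'; rewrite E' eqxx in zf.
Qed.

(** Otherwise a 2-edge cut [{c, d}] around some [A] separates [g] from [e1]. This forces [c] inside
    [S], and uncrossing [A] with the pendant part [B] around [c] gives a contradiction. *)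
Lemma core_avoid E S e1 F g h c : tec E -> side E S e1 -> tec F -> F \subset E ->
  core E S e1 \subset F -> g \in F -> h \in F -> crosses S g -> crosses S h ->
  (forall f, f \in F -> crosses S f -> f = g \/ f = h) ->
  c \in F -> c \notin core E S e1 -> ~~ eqv F c g ->
  exists M, [/\ tec M, M \subset F, g \in M, e1 \in M & c \notin M].
Proof.
move=> tE sd tF FE LF gF hF gS hS cutF cF cL cg.
have F2 f : f \in F -> #|f| = 2 by apply: tec2.
have e1L := core_mem tE sd; have e1F := subsetP LF _ e1L.
have tL : tec (core E S e1) := core_tec _ _ _.
have gc : g != c by apply: contraNneq cg => ->; apply: eqv_refl.
have ec : e1 != c by apply: contraNneq cL => <-.
have [[M [? ? ? ? ?]]|[A [d [gA eA [[_ dF cA dA cd] cutA]]]]] := tec_or_two_cut tF gF e1F gc ec.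
  by exists M.
exfalso.
have gh : eqv F g h by apply: (cut_eqv gS hS cutF).
(* [M] avoids [c], hence also the equivalent edge [d], so it stays inside [A]; it contains [h] with
   [g]. *)
have [cg'|[M [tM MF gM cM]]] := eqv_or_sep tF cF gF; first by rewrite cg' in cg.
have hM := eqv_mem gh tM MF gM.
have dM : d \notin M by apply: contra cM; apply: eqv_mem tM MF; rewrite eqv_sym.
have MA y : y \in M -> y \subset A.
  move=> yM; apply: (tec_in tM _ gM gA yM) => z zM; apply/negP => zA.
  by case: (cutA z (subsetP MF _ zM) zA) => E'; [rewrite -E' zM in cM | rewrite -E' zM in dM].
have dL : d \notin core E S e1 by apply: contra cL; apply: eqv_mem tL LF; rewrite eqv_sym.
have eA' : e1 \subset ~: A.
  apply: (tec_out tL _ e1L eA e1L) => z zL; apply/negP => zA.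
  by case: (cutA z (subsetP LF _ zL) zA) => E'; [rewrite -E' zL in cL | rewrite -E' zL in dL].
have [e1E e1S _ _ _] := sd.
have cS : c \subset S.
  (* As [g] and [h] lie inside [A], an edge other than [d] crossing [S :\: A] lies inside [S] and
     must be [c]. *)
  have [f [fF fA fd]] : exists f, [/\ f \in F, crosses (S :\: A) f & f != d].
    apply: (tec_cross d tF e1F gF).
      by move: eA' e1S; edge_cases (F2 _ e1F).
    by move: (MA _ gM); edge_cases (F2 _ gF).
  have fS : ~~ crosses S f.
    apply/negP => /(cutF f fF) [] fE; subst f; move: fA.
      by move: (MA _ gM); edge_cases (F2 _ gF).
    by move: (MA _ hM); edge_cases (F2 _ hF).
  have fA' : crosses A f by move: fA fS; edge_cases (F2 _ fF).
  case: (cutA f fF fA') fd => [<- _|->]; last by rewrite eqxx.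
  by move: fA fS; edge_cases (F2 _ fF).
have [B [f [g' [[BS cB eB] [fE fS fB] [g'E g'S g'B] cutB]]]] :=
  pendant tE sd (subsetP FE _ cF) cS cL.
have eB' : ~~ (e1 \subset B) by move: eB; edge_cases (F2 _ e1F).
have [fF g'F fg'] := tec_cap_other tF FE cF e1F cB eB' cutB.
have gg' : eqv F g g'.
  by case: (cutF g' g'F g'S) => ->; [apply: eqv_refl | apply: gh].
have g'M := eqv_mem gg' tM MF gM.
have fM : f \in M by apply: eqv_mem tM MF g'M; rewrite eqv_sym.
have cB' : c \subset B.
  have [cB1|/(ncrosses_side (F2 _ cF))] := boolP (crosses B c); last by rewrite (negbTE cB) orbF.
  by case: (cutB c (subsetP FE _ cF) cB1) => E'; rewrite E' ?fM ?g'M in cM.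
(* Only [d] can cross [A :|: B]: [c] lies inside [B], and the two edges leaving [B] belong to [M],
   hence lie inside [A]. *)
have [y [yF yAB yd]] : exists y, [/\ y \in F, crosses (A :|: B) y & y != d].
  apply: (tec_cross d tF gF e1F).
    by move: (MA _ gM); edge_cases (F2 _ gF).
  by move: eA' eB; edge_cases (F2 _ e1F).
have [yA|yA] := boolP (crosses A y).
  case: (cutA y yF yA) => yE; last by rewrite yE eqxx in yd.
  by subst y; move: yAB cB'; edge_cases (F2 _ cF).
have yB : crosses B y by move: yAB yA; edge_cases (F2 _ yF).
have yM : y \in M by case: (cutB y (subsetP FE _ yF) yB) => ->.
by move: yAB (MA _ yM); edge_cases (F2 _ yF).
Qed.

Section Weights.
Variables (V : zmodType) (a : {set T} -> V).
Local Open Scope ring_scope.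

(** A class avoided by a subgraph through [e1] and [e2] vanishes by [wt_cls_eq0]. For the others,
    tightness inside the core [L] is used: the class of [c] in [L] has weight zero and is a union of
    classes of [F], at most one of which is not avoidable in this way. *)
Lemma core_cls0 E S e1 e2 F g h : tec E -> side E S e1 -> side E (~: S) e2 ->
  tec F -> F \subset E -> core E S e1 \subset F -> core E (~: S) e2 \subset F ->
  g \in F -> h \in F -> crosses S g -> crosses S h ->
  (forall f, f \in F -> crosses S f -> f = g \/ f = h) ->
  (forall H, tec H -> e1 \in H -> H \subset core E S e1 -> wt a H = 0) ->
  (forall H, tec H -> e1 \in H -> e2 \in H -> H \subset F -> wt a H = 0) ->
  forall c, c \in core E S e1 -> wt a (cls F c) = 0.
Proof.
move=> tE sd1 sd2 tF FE L1F L2F gF hF gS hS cutF a1 a12.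
set L := core E S e1; have tL : tec L := core_tec _ _ _.
have F2 f : f \in F -> #|f| = 2 by apply: tec2.
have e1L : e1 \in L := core_mem tE sd1; have e1F := subsetP L1F _ e1L.
have e2F := subsetP L2F _ (core_mem tE sd2).
have LS f : f \in L -> f \subset S by case/core_sub.
have gL : g \notin L by apply: contraL gS => /LS; apply: sub_ncrosses; apply: F2.
have gh : eqv F g h by apply: (cut_eqv gS hS cutF).
pose good x := exists M, [/\ tec M, M \subset F, e1 \in M, e2 \in M & x \notin M].
have good0 x : x \in F -> good x -> wt a (cls F x) = 0.
  move=> xF [M [tM MF e1M e2M xM]].
  apply: (@wt_cls_eq0 _ _ a F [set e1; e2] e1) => //.
  - by rewrite !inE eqxx.
  - by rewrite subset2 e1F.
  - by move=> H tH; rewrite subset2 => /andP [? ?]; apply: a12.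
  - by exists M; rewrite subset2 e1M e2M.
(* A subgraph through [c] avoiding [f] cannot stay in [S]: it would be part of [L], where [c] and
   [f] are equivalent. So it contains [g], and [core_avoid] on the opposite shore extends it to
   [e2]. *)
have sepN c f : c \in L -> f \in L -> eqv L c f -> ~~ eqv F c f ->
    exists N, [/\ [/\ tec N, N \subset F & c \in N], g \in N, e2 \in N & f \notin N].
  move=> cL fL cf ncf.
  have cF := subsetP L1F _ cL; have fF := subsetP L1F _ fL.
  have [fc|[M [tM MF cM fM]]] := eqv_or_sep tF fF cF; first by rewrite eqv_sym fc in ncf.
  have [MS|] := boolP [forall y in M, y \subset S].
    case/negP: fM; apply: (eqv_mem cf tM _ cM).
    apply: (core_join tE sd1 tM (subset_trans MF FE) _ cM cL) => y yM.
    exact: (forall_inP MS).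
  rewrite negb_forall => /existsP [y]; rewrite negb_imply => /andP [yM yS].
  have cS : ~~ (c \subset ~: S) by apply: sub_nsubC (LS _ cL); apply: F2.
  have [z [zM zS _]] := tec_cross set0 tM cM yM cS yS.
  have gM : g \in M.
    case: (cutF z (subsetP MF _ zM) zS) => zE; subst z => //.
    by apply: eqv_mem tM MF zM; rewrite eqv_sym.
  have [||||||M' [tM' MF' gM' e2M' fM']] := @core_avoid E (~: S) e2 F g h f tE sd2 tF FE L2F gF hF.
  - by rewrite crossesC // F2.
  - by rewrite crossesC // F2.
  - by move=> x xF; rewrite crossesC ?F2 //; apply: cutF.
  - by [].
  - apply/negP => /core_sub [_]; apply/negP; apply: sub_nsubC (LS _ fL); exact: F2.
  - by apply: contra gL => fg; apply: eqv_mem fg tL L1F fL.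
  exists (M :|: M'); rewrite !inE cM gM e2M' orbT subUset MF MF' negb_or fM fM'; split=> //.
  by split=> //; apply: tecU1 gM gM'.
move=> c cL; have cF := subsetP L1F _ cL.
have [/existsP [M /and5P [? ? ? ? ?]]|bad] := boolP [exists M : {set {set T}},
   [&& tec M, M \subset F, e1 \in M, e2 \in M & c \notin M]].
  by apply: good0 => //; exists M.
have cl : closed_cls F (cls L c).
  split=> [|f x]; first exact: subset_trans (cls_sub _ _) L1F.
  rewrite inE => /andP [fL cf] xF fx; rewrite inE (eqv_mem fx tL L1F fL) /=.
  exact: eqv_trans cf (eqv_sub L1F fx).
rewrite -(wt_closed1 cl (mem_cls cL)).
  apply: (wt_cls_eq0_edge tL e1L) => // H tH e1H HL; exact: a1.
move=> f; rewrite inE => /andP [fL cf] ncf.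
have fF := subsetP L1F _ fL; apply: good0 => //.
have [/existsP [M /and5P [? ? ? ? ?]]|badf] := boolP [exists M : {set {set T}},
   [&& tec M, M \subset F, e1 \in M, e2 \in M & f \notin M]].
  by exists M.
exfalso.
(* Suppose that neither [c] nor [f] is good. Then [N] and [N'] miss [e1], as otherwise they would
   show that [f], respectively [c], is good. *)
have [N [[tN NF cN] gN e2N fN]] := sepN _ _ cL fL cf ncf.
have [||N' [[tN' NF' fN'] gN' e2N' cN']] := @sepN f c fL cL _ _.
- by rewrite eqv_sym.
- by rewrite eqv_sym.
have e1N : e1 \notin N.
  by apply: contra badf => e1N; apply/existsP; exists N; rewrite tN NF e1N e2N.
have e1N' : e1 \notin N'.
  by apply: contra bad => e1N'; apply/existsP; exists N'; rewrite tN' NF' e1N' e2N'.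
have fc : f != c by apply: contraNneq cN' => <-.
(* As [x] is not good, a 2-edge cut [{x, d}] separates [e1] from the subgraph [M'], while [M]
   contains both edges of this cut. *)
have cut_side x y M' M : x \in F -> y \in M' -> tec M' -> M' \subset F -> e2 \in M' ->
    x \notin M' -> tec M -> M \subset F -> x \in M -> e1 \notin M -> e1 \notin M' ->
    ~~ [exists M : {set {set T}}, [&& tec M, M \subset F, e1 \in M, e2 \in M & x \notin M]] ->
    exists A d, [/\ forall z, z \in M' -> z \subset A, e1 \subset ~: A, x \in M, d \in M &
      forall z, z \in F -> crosses A z -> z = x \/ z = d].
  move=> xF yM tM' M'F e2M' xM' tM MF xM e1M e1M' badx.
  have yF := subsetP M'F _ yM.
  have yx : y != x by apply: contraNneq xM' => <-.
  have ex : e1 != x by apply: contraNneq e1M => ->.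
  have [[H [tH HF yH e1H xH]]|[A [d [yA eA [[_ dF xA dA xd] cutA]]]]] := tec_or_two_cut tF yF e1F yx ex.
    case/negP: badx; apply/existsP; exists (H :|: M').
    rewrite (tecU1 tH tM' yH yM) subUset HF M'F !inE e1H e2M' orbT negb_or xH xM' //.
  have dM := eqv_mem xd tM MF xM.
  have dM' : d \notin M' by apply: contra xM'; apply: eqv_mem tM' M'F; rewrite eqv_sym.
  exists A, d; split=> // [z zM|].
    apply: (tec_in tM' _ yM yA zM) => w wM; apply/negP => wA.
    by case: (cutA w (subsetP M'F _ wM) wA) => E'; [rewrite -E' wM in xM' | rewrite -E' wM in dM'].
  have [e1A|/(ncrosses_side (F2 _ e1F))] := boolP (crosses A e1); last by rewrite (negbTE eA).
  case: (cutA _ e1F e1A) => E'; first by rewrite E' eqxx in ex.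
  by rewrite E' dM in e1M.
have [A [d' [NA e1A _ d'N' cutA]]] := cut_side f c N N' fF cN tN NF e2N fN tN' NF' fN' e1N' e1N badf.
have [B [d [N'B e1B _ dN cutB]]] := cut_side c f N' N cF fN' tN' NF' e2N' cN' tN NF cN e1N e1N' bad.
(* The edges leaving [A] lie in [N'], hence inside [B], and those leaving [B] lie in [N], hence
   inside [A]; so nothing leaves [A :|: B], although it separates [g] from [e1]. *)
have [z [zF zAB _]] : exists z, [/\ z \in F, crosses (A :|: B) z & z != set0].
  apply: (tec_cross set0 tF gF e1F).
    by move: (NA _ gN); edge_cases (F2 _ gF).
  by move: e1A e1B; edge_cases (F2 _ e1F).
have [zA|zA] := boolP (crosses A z).
  have zN' : z \in N' by case: (cutA _ zF zA) => ->.
  by move: zAB (N'B _ zN'); edge_cases (F2 _ zF).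
have zB : crosses B z by move: zAB zA; edge_cases (F2 _ zF).
have zN : z \in N by case: (cutB _ zF zB) => ->.
by move: zAB (NA _ zN); edge_cases (F2 _ zF).
Qed.

End Weights.
End Pairs.

(** * Restricting the set of cut edges *)

Section CutSubsets.
Variable T : finType.
Implicit Types (A B C S W f g h c d i j x y z e : {set T}) (E F G H K M N X Y Z I J : {set {set T}}).

(* The graph K_I: [G] without the chains of the cut edges outside [I]. *)
Definition KI E S e1 e2 I := mtec (cutI E S I) [set e1; e2].

Lemma KIC E S e1 e2 I : tec E -> KI E (~: S) e2 e1 I = KI E S e1 e2 I.
Proof. by move=> tE; rewrite /KI cutIC // setUC. Qed.

Lemma KI_tec E S e1 e2 I : tec (KI E S e1 e2 I).
Proof. by apply: (mtec_tec _ (e := e1)); rewrite !inE eqxx. Qed.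

Lemma KI_sub E S e1 e2 I : KI E S e1 e2 I \subset E.
Proof. exact: subset_trans (mtec_sub _ _) (cutI_sub _ _ _). Qed.

Lemma KI_cross E S e1 e2 I f : f \in KI E S e1 e2 I -> crosses S f -> f \in I.
Proof. by move/(subsetP (mtec_sub _ _)); apply: cutI_cross. Qed.

Lemma KIS E S e1 e2 I J : I \subset J -> KI E S e1 e2 I \subset KI E S e1 e2 J.
Proof.
move=> IJ; apply/bigcupsP => H /and3P [tH XH HF]; apply: mtec_max => //.
exact: subset_trans HF (cutIS _ _ IJ).
Qed.

Lemma KI_join E S e1 e2 I H y : e1 \in KI E S e1 e2 I -> e2 \in KI E S e1 e2 I ->
  tec H -> H \subset cutI E S I -> y \in H -> y \in KI E S e1 e2 I -> H \subset KI E S e1 e2 I.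
Proof.
move=> e1K e2K tH HF yH yK; apply: (@mtec_join1 _ _ _ e1 _ y) => //; first by rewrite !inE eqxx.
by rewrite subset2 e1K.
Qed.

Lemma KI_pair E S e1 e2 g h : tec E -> side E S e1 -> side E (~: S) e2 ->
  g \in E -> h \in E -> crosses S g -> crosses S h -> g != h ->
  let K := KI E S e1 e2 [set g; h] in [/\ e1 \in K, e2 \in K, g \in K & h \in K].
Proof.
move=> tE sd1 sd2 gE hE gS hS gh K.
have [H [tH HF gH e1H e2H]] := pair_tec tE sd1 sd2 gE hE gS hS gh.
have HK : H \subset K by apply: mtec_max => //; rewrite subset2 e1H.
have gK := subsetP HK _ gH.
split=> //; try exact: (subsetP HK).
have [f [fK fS fg]] := tec_cross_other (KI_tec _ _ _ _ _) gK gS.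
by move: (KI_cross fK fS) fg; rewrite !inE => /orP [->//|/eqP <-].
Qed.

Lemma KI_mem E S e1 e2 I : tec E -> side E S e1 -> side E (~: S) e2 ->
  (forall i, i \in I -> i \in E /\ crosses S i) -> 1 < #|I| ->
  [/\ e1 \in KI E S e1 e2 I, e2 \in KI E S e1 e2 I & I \subset KI E S e1 e2 I].
Proof.
move=> tE sd1 sd2 IE I2; set K := KI _ _ _ _ _.
have pairK g h : g \in I -> h \in I -> g != h ->
    [/\ e1 \in K, e2 \in K, g \in K & h \in K].
  move=> gI hI gh; have [[gE gS] [hE hS]] := (IE _ gI, IE _ hI).
  have /subsetP sub : KI E S e1 e2 [set g; h] \subset K by apply: KIS; rewrite subset2 gI.
  by have [*] := KI_pair tE sd1 sd2 gE hE gS hS gh; split; apply: sub.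
have /card_gt1P [g [h [gI hI gh]]] := I2.
have [e1K e2K gK _] := pairK _ _ gI hI gh.
split=> //; apply/subsetP => i iI; case: (eqVneq i g) => [->//|ig].
by have [] := pairK _ _ iI gI ig.
Qed.

Lemma core_KI E S e1 e2 I : tec E -> side E S e1 -> e1 \in KI E S e1 e2 I ->
  e2 \in KI E S e1 e2 I -> core E S e1 \subset KI E S e1 e2 I.
Proof.
move=> tE sd e1K e2K; apply: (KI_join e1K e2K (core_tec _ _ _) _ (core_mem tE sd) e1K).
apply/subsetP => f /core_sub [fE fS]; apply: cutIP => // fS'.
by move: (sub_ncrosses (tec2 tE fE) fS); rewrite fS'.
Qed.

(** A subgraph of K_I through [c] avoiding [i] and [f] would lie in K_{I - i} and separate [c] from
    [f] there. So [c] is a bridge once [i] and [f] are removed. If [f] did not cross its cut, [c]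
    would be a bridge of K_{I - i}; if [i] did not, [c] and [f] would be equivalent in K_I. *)
Lemma three_cut E S e1 e2 I i c f : tec E ->
  let F := KI E S e1 e2 I in let F' := KI E S e1 e2 (I :\ i) in
  crosses S i -> e1 \in F' -> e2 \in F' -> c \in F' -> f \in F' -> eqv F' c f -> ~~ eqv F c f ->
  exists A, [/\ crosses A c, crosses A f, crosses A i &
    forall y, y \in F -> crosses A y -> [\/ y = c, y = f | y = i]].
Proof.
move=> tE F F' iS e1F e2F cF' fF' cf ncf.
have F'F : F' \subset F by apply: KIS; apply: subD1set.
have tF : tec F := KI_tec _ _ _ _ _.
have tF' : tec F' := KI_tec _ _ _ _ _.
have iF' : i \notin F' by apply/negP => /KI_cross /(_ iS); rewrite !inE eqxx.
have fc : c != f by apply: contraNneq ncf => ->; apply: eqv_refl.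
have sF : simple (F :\ i :\ f).
  by apply: simpleS (tec_simple tF); apply: subset_trans (subD1set _ _) (subD1set _ _).
have cF : c \in F :\ i :\ f.
  rewrite !inE fc (subsetP F'F) // andbT /=; by apply: contraNneq iF' => <-.
have [[H [tH HF cH]]|[A [cA cutA]]] := tec_or_bridge1 sF cF.
  have [] : f \notin H /\ f \in H; last by move=> /negP.
  split; first by apply/negP => /(subsetP HF); rewrite !inE eqxx.
  apply: (eqv_mem cf tH _ cH); apply: (KI_join e1F e2F tH _ cH cF').
  apply/subsetP => y /(subsetP HF) /setD1P [_ /setD1P [yi yF]].
  by apply: cutIP => [|yS]; [apply: (subsetP (KI_sub _ _ _ _ _)) yF | rewrite !inE yi (KI_cross yF)].
have cut3 y : y \in F -> crosses A y -> [\/ y = c, y = f | y = i].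
  move=> yF yA; case: (eqVneq y f) => [->|yf]; first by constructor 2.
  case: (eqVneq y i) => [->|yi]; first by constructor 3.
  by constructor 1; apply: cutA => //; rewrite !inE yf yi.
have fA : crosses A f.
  have [y [yF yA yc]] := tec_cross_other tF' cF' cA.
  case: (cut3 y (subsetP F'F _ yF) yA) => E'; subst y => //; first by rewrite eqxx in yc.
  by rewrite yF in iF'.
exists A; split=> //; apply: contraR ncf => niA.
apply: (cut_eqv cA fA) => y yF yA; case: (cut3 y yF yA) => E'; [by left|by right|].
by rewrite -E' yA in niA.
Qed.

Lemma three_cut_core E S e1 e2 I i c f : tec E -> side E S e1 -> side E (~: S) e2 ->
  (forall i, i \in I -> i \in E /\ crosses S i) -> 2 < #|I| -> i \in I ->
  let F := KI E S e1 e2 I in let F' := KI E S e1 e2 (I :\ i) in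
  c \in core E S e1 -> f \in F' -> eqv F' c f -> ~~ eqv F c f ->
  exists A, [/\ A \subset S, f \in core E S e1, [/\ crosses A c, crosses A f & crosses A i] &
    forall y, y \in F -> crosses A y -> [\/ y = c, y = f | y = i]].
Proof.
move=> tE sd1 sd2 IE I3 iI F F' cL fF' cf ncf.
have [iE iS] := IE _ iI.
have I'2 : 1 < #|I :\ i| by move: I3; rewrite (cardsD1 i I) iI.
have IE' j : j \in I :\ i -> j \in E /\ crosses S j by rewrite inE => /andP [_ /IE].
have [e1F' e2F' _] := KI_mem tE sd1 sd2 IE' I'2.
have F'F : F' \subset F by apply: KIS; apply: subD1set.
have L1F' : core E S e1 \subset F' by apply: core_KI.
have fL : f \in core E S e1 by apply: eqv_mem cf (core_tec _ _ _) L1F' cL.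
have [A0 [cA0 fA0 iA0 cut0]] := three_cut tE iS e1F' e2F' (subsetP L1F' _ cL) fF' cf ncf.
have E2 y : y \in E -> #|y| = 2 by apply: tec2.
have FE : F \subset E by apply: KI_sub.
have F2 y : y \in F -> #|y| = 2 by move=> yF; apply: E2; apply: (subsetP FE).
have e2F := subsetP F'F _ e2F'.
have [cS fS] : c \subset S /\ f \subset S by split; [case/core_sub: cL | case/core_sub: fL].
have cF := subsetP F'F _ (subsetP L1F' _ cL); have fF := subsetP F'F _ fF'.
have nSC y A : y \in F -> y \subset ~: S -> crosses A y ->
    (forall y, y \in F -> crosses A y -> [\/ y = c, y = f | y = i]) -> False.
  move=> yF yS yA h; case: (h y yF yA) => E'; subst y.
  - by move: cS yS; edge_cases (F2 _ yF).
  - by move: fS yS; edge_cases (F2 _ yF).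
  - by move: iS yS; edge_cases (F2 _ yF).
have [_ e2S _ _ _] := sd2.
have [A [e2A cA fA iA cutA]] : exists A, [/\ e2 \subset ~: A, crosses A c, crosses A f,
    crosses A i & forall y, y \in F -> crosses A y -> [\/ y = c, y = f | y = i]].
  have ne2 : ~~ crosses A0 e2 by apply/negP => h; apply: (nSC _ _ e2F e2S h cut0).
  case/orP: (ncrosses_side (F2 _ e2F) ne2) => e2A; last by exists A0.
  exists (~: A0); rewrite setCK !crossesC ?(F2 c) ?(F2 f) ?(E2 i) //; split=> // y yF.
  by rewrite crossesC ?F2 //; apply: cut0.
pose C := A :\: S.
(* No edge of the opposite shore crosses [A], so edges leaving [C] are cut edges. With two of them,
   [g] and [h], the graph K_{g,h} would enter the opposite shore only inside [C] and could not reach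
   [e2]. *)
have noC y : y \in F -> y \subset ~: C.
  move=> yF; apply/negPn/negP => yC.
  have e2C : ~~ (e2 \subset C) by move: e2A; edge_cases (F2 _ e2F).
  have cross_C z : z \in F -> crosses C z -> crosses S z.
    move=> zF zC; apply/negPn/negP => zS.
    apply: (nSC z A zF); last exact: cutA.
      by move: zC zS; edge_cases (F2 _ zF).
    by move: zC zS; edge_cases (F2 _ zF).
  have tF : tec F := KI_tec _ _ _ _ _.
  have [g [gF gC _]] := tec_cross set0 tF yF e2F yC e2C.
  have [h [hF hC hg]] := tec_cross g tF yF e2F yC e2C.
  have [gS hS] := (cross_C _ gF gC, cross_C _ hF hC).
  have gE := subsetP FE _ gF; have hE := subsetP FE _ hF.
  have gh : g != h by rewrite eq_sym.
  have [_ e2K gK hK] := KI_pair tE sd1 sd2 gE hE gS hS gh.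
  have KF : KI E S e1 e2 [set g; h] \subset F.
    by apply: KIS; rewrite subset2 (KI_cross gF gS) (KI_cross hF hS).
  have [z [zK zC _]] : exists z, [/\ z \in KI E S e1 e2 [set g; h], crosses (C :|: S) z & z != set0].
    apply: (tec_cross set0 (KI_tec _ _ _ _ _) gK e2K).
      by move: gC; edge_cases (F2 _ gF).
    by move: e2A e2S; edge_cases (F2 _ e2F).
  have zF := subsetP KF _ zK.
  have [zS|zS] := boolP (crosses S z); last first.
    apply: (nSC z A zF _ _ cutA); first by move: zC zS; edge_cases (F2 _ zF).
    by move: zC zS; edge_cases (F2 _ zF).
  have zC' : crosses C z.
    by move: (KI_cross zK zS); rewrite !inE => /orP [] /eqP ->.
  by move: zC zS zC'; edge_cases (F2 _ zF).
have AE y : y \in F -> crosses (A :&: S) y = crosses A y.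
  by move=> yF; move: (noC _ yF); edge_cases (F2 _ yF).
have iF : i \in F.
  by have [_ _ /subsetP ->] := KI_mem tE sd1 sd2 IE (ltnW I3).
exists (A :&: S); split=> //; first exact: subsetIr.
  by rewrite !AE.
by move=> y yF; rewrite AE //; apply: cutA.
Qed.

(* Uncrossing: the three-edge cuts of [Ai] and [Aj] would make [c] a bridge of the core. *)
Lemma three_cuts_same_side E S e1 F c i j fi fj (Ai Aj : {set T}) u v : tec F -> F \subset E ->
  core E S e1 \subset F -> i \in E -> j \in E -> crosses S i -> crosses S j -> i != j ->
  c = [set u; v] -> u \in Ai -> u \in Aj -> v \notin Ai -> v \notin Aj ->
  c \in core E S e1 -> ~~ eqv F c fi -> ~~ eqv F c fj ->
  [/\ Ai \subset S, fi \in core E S e1, [/\ crosses Ai c, crosses Ai fi & crosses Ai i] &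
    forall y, y \in F -> crosses Ai y -> [\/ y = c, y = fi | y = i]] ->
  [/\ Aj \subset S, fj \in core E S e1, [/\ crosses Aj c, crosses Aj fj & crosses Aj j] &
    forall y, y \in F -> crosses Aj y -> [\/ y = c, y = fj | y = j]] -> False.
Proof.
move=> tF FE LF iE jE iS jS ij cE ui uj vi vj cL nfi nfj.
case=> AiS fiL [cAi fiAi iAi] cuti [AjS fjL [cAj fjAj jAj] cutj].
have F2 y : y \in F -> #|y| = 2 by apply: tec2.
have LS y : y \in core E S e1 -> y \subset S by case/core_sub.
have LnS y : y \in core E S e1 -> ~~ crosses S y.
  by move=> yL; apply: sub_ncrosses (LS _ yL); apply: F2; apply: (subsetP LF).
have [cF fiF fjF] : [/\ c \in F, fi \in F & fj \in F] by split; apply: (subsetP LF).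
have uv : u != v by apply: contraTneq ui => ->.
(* The end of [i] in [S] would lie in [Aj] and the other end does not, so [i] would be one of the
   three edges leaving [Aj]. *)
have iP : i \in F -> ~~ crosses (Ai :&: Aj) i.
  move=> iF; apply/negP => iP.
  have : crosses Aj i.
    have := subsetP AiS; have := subsetP AjS.
    have [p [q [iE' pS qS]]] := crossesP (F2 _ iF) iS => sj si.
    move: iP; rewrite iE' !crosses2 ?inE; try by apply: contraNneq qS => <-.
    have -> : (q \in Ai) = false by apply/negP => /si; apply/negP.
    have -> : (q \in Aj) = false by apply/negP => /sj; apply/negP.
    by case: (p \in Ai) => //=; case: (p \in Aj).
  case/(cutj i iF) => E'; subst i; last by rewrite eqxx in ij.
  - by move: (LnS _ cL); rewrite iS.
  - by move: (LnS _ fjL); rewrite iS.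
have jP : j \in F -> ~~ crosses (Ai :&: Aj) j.
  move=> jF; apply/negP => jP.
  have : crosses Ai j.
    have := subsetP AiS; have := subsetP AjS.
    have [p [q [jE' pS qS]]] := crossesP (F2 _ jF) jS => sj si.
    move: jP; rewrite jE' !crosses2 ?inE; try by apply: contraNneq qS => <-.
    have -> : (q \in Ai) = false by apply/negP => /si; apply/negP.
    have -> : (q \in Aj) = false by apply/negP => /sj; apply/negP.
    by case: (p \in Ai) => //=; case: (p \in Aj).
  case/(cuti j jF) => E'; subst j; last by rewrite eqxx in ij.
  - by move: (LnS _ cL); rewrite jS.
  - by move: (LnS _ fiL); rewrite jS.
have cP : crosses (Ai :&: Aj) c by rewrite cE crosses2 // !inE ui uj (negbTE vi).
have cU : crosses (Ai :|: Aj) c by rewrite cE crosses2 // !inE ui (negbTE vi) (negbTE vj).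
have cutP y : y \in F -> crosses (Ai :&: Aj) y -> [\/ y = c, y = fi | y = fj].
  move=> yF yP; have [yi|yi] := boolP (crosses Ai y).
    case: (cuti y yF yi) => E'; [by constructor 1|by constructor 2|].
    by subst y; move: (iP yF); rewrite yP.
  have yj : crosses Aj y by move: yP yi; edge_cases (F2 _ yF).
  case: (cutj y yF yj) => E'; [by constructor 1|by constructor 3|].
  by subst y; move: (jP yF); rewrite yP.
have nci : c != fi by apply: contraNneq nfi => <-; apply: eqv_refl.
have ncj : c != fj by apply: contraNneq nfj => <-; apply: eqv_refl.
(* Otherwise [c] and [fj] alone leave the intersection and are equivalent. *)
have fiP : crosses (Ai :&: Aj) fi.
  apply: contraR nfj => nfiP.
  have [y [yF yP yc]] := tec_cross_other tF cF cP.
  have fjP : crosses (Ai :&: Aj) fj.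
    by case: (cutP y yF yP) => E'; subst y => //; [rewrite eqxx in yc | rewrite yP in nfiP].
  apply: (cut_eqv cP fjP) => z zF zP; case: (cutP z zF zP) => E'; [by left| |by right].
  by subst z; rewrite zP in nfiP.
have fjP : crosses (Ai :&: Aj) fj.
  apply: contraR nfi => nfjP.
  apply: (cut_eqv cP fiP) => z zF zP; case: (cutP z zF zP) => E'; [by left|by right|].
  by subst z; rewrite zP in nfjP.
have fij : fi != fj.
  apply: contraNneq nfi => E'; apply: (cut_eqv cP fiP) => z zF zP.
  by case: (cutP z zF zP) => ->; [left|right|right; rewrite E'].
have fiS := LnS _ fiL; have fjS := LnS _ fjL.
have fiAj : ~~ crosses Aj fi.
  apply/negP => /(cutj fi fiF) [] E'; first by rewrite E' eqxx in nci.
    by rewrite E' eqxx in fij.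
  by rewrite E' jS in fiS.
have fjAi : ~~ crosses Ai fj.
  apply/negP => /(cuti fj fjF) [] E'; first by rewrite E' eqxx in ncj.
    by rewrite E' eqxx in fij.
  by rewrite E' iS in fjS.
(* Now [fi] lies inside [Aj] and [fj] inside [Ai], so [c] is the only edge of the core that leaves
   the union. *)
have [y [yL yU yc]] := tec_cross_other (core_tec E S e1) cL cU.
have yF := subsetP LF _ yL; have yS := LnS _ yL.
have [yi|yi] := boolP (crosses Ai y).
  case: (cuti y yF yi) => E'; subst y; first by rewrite eqxx in yc.
    by move: fiP fiAj yU; edge_cases (F2 _ yF).
  by rewrite iS in yS.
have yj : crosses Aj y by move: yU yi; edge_cases (F2 _ yF).
case: (cutj y yF yj) => E'; subst y; first by rewrite eqxx in yc.
  by move: fjP fjAi yU; edge_cases (F2 _ yF).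
by rewrite jS in yS.
Qed.

End CutSubsets.

(** * Reducing the number of cut edges *)

Section Induction.
Variable T : finType.
Implicit Types (A B C D S W f g h c d i j x y z e : {set T}) (E F G H K M N X Y Z I J : {set {set T}}).

(** By [eqv_sub] the class of [c] is then the same in K_I and in K_{I - i}, which drives the
    induction in [KI_cls0]. *)
Definition reducible E S e1 e2 I c := exists i, [/\ i \in I, c \in KI E S e1 e2 (I :\ i) &
  forall f, f \in KI E S e1 e2 (I :\ i) -> eqv (KI E S e1 e2 (I :\ i)) c f ->
    eqv (KI E S e1 e2 I) c f].

(** Otherwise each [i] in [I] yields a three-edge cut by [three_cut_core]. Among three of these, two
    contain the same end of [c], against [three_cuts_same_side]. *)
Lemma core_reducible E S e1 e2 I c : tec E -> side E S e1 -> side E (~: S) e2 ->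
  (forall i, i \in I -> i \in E /\ crosses S i) -> 2 < #|I| -> c \in core E S e1 ->
  reducible E S e1 e2 I c.
Proof.
move=> tE sd1 sd2 IE I3 cL; pose K := KI E S e1 e2.
have [/exists_inP [i iI /andP [ci /forall_inP h]]|nex] := boolP [exists i in I, (c \in K (I :\ i)) &&
   [forall f in K (I :\ i), eqv (K (I :\ i)) c f ==> eqv (K I) c f]].
  by exists i; split=> // f fK; apply/implyP; apply: h.
exfalso.
have [e1F e2F _] := KI_mem tE sd1 sd2 IE (ltnW I3).
have LF : core E S e1 \subset K I by apply: core_KI.
pose P3 i f A := [/\ A \subset S, f \in core E S e1, [/\ crosses A c, crosses A f & crosses A i] &
    forall y, y \in K I -> crosses A y -> [\/ y = c, y = f | y = i]].
have cutP i : i \in I -> exists f A, ~~ eqv (K I) c f /\ P3 i f A.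
  move=> iI.
  have I'2 : 1 < #|I :\ i| by move: I3; rewrite (cardsD1 i I) iI.
  have IE' j : j \in I :\ i -> j \in E /\ crosses S j by rewrite inE => /andP [_ /IE].
  have [e1F' e2F' _] := KI_mem tE sd1 sd2 IE' I'2.
  have cF' : c \in K (I :\ i) by apply: (subsetP (core_KI tE sd1 e1F' e2F')).
  have [hall|] := boolP [forall f in K (I :\ i), eqv (K (I :\ i)) c f ==> eqv (K I) c f].
    by case/negP: nex; apply/exists_inP; exists i; rewrite // cF'.
  rewrite negb_forall => /existsP [f]; rewrite negb_imply => /andP [fF'].
  rewrite negb_imply => /andP [cf ncf]; exists f.
  by have [A hA] := three_cut_core tE sd1 sd2 IE I3 iI cL fF' cf ncf; exists A.
have tF : tec (K I) := KI_tec _ _ _ _ _.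
have [u [v [uv cE]]] := edgeE (tec2 (core_tec _ _ _) cL).
have same i j fi fj (Ai Aj : {set T}) p q : i \in I -> j \in I -> i != j -> c = [set p; q] ->
    p \in Ai -> p \in Aj -> q \notin Ai -> q \notin Aj -> ~~ eqv (K I) c fi -> ~~ eqv (K I) c fj ->
    P3 i fi Ai -> P3 j fj Aj -> False.
  move=> /IE [iE iS] /IE [jE jS] ij cE' pi pj qi qj ni nj.
  exact: (three_cuts_same_side tF (KI_sub _ _ _ _ _) LF iE jE iS jS ij cE' pi pj qi qj cL ni nj).
have cE' : c = [set v; u] by rewrite setUC.
have orient A : crosses A c -> (u \in A /\ v \notin A) \/ (v \in A /\ u \notin A).
  by rewrite cE crosses2 //; case: (u \in A); case: (v \in A); [|left|right|].
have /card_gt2P [i [j [k [[iI jI kI] [ij jk ki]]]]] := I3.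
have ik : i != k by rewrite eq_sym.
have [fi [Ai [nfi Pi]]] := cutP i iI.
have [fj [Aj [nfj Pj]]] := cutP j jI.
have [fk [Ak [nfk Pk]]] := cutP k kI.
have oi : crosses Ai c by case: Pi => _ _ [].
have oj : crosses Aj c by case: Pj => _ _ [].
have ok : crosses Ak c by case: Pk => _ _ [].
case: (orient _ oi) => [] [ui vi]; case: (orient _ oj) => [] [uj vj];
  case: (orient _ ok) => [] [uk vk];
  first [exact: (same _ _ _ _ _ _ _ _ iI jI ij cE ui uj vi vj nfi nfj Pi Pj)
        |exact: (same _ _ _ _ _ _ _ _ iI jI ij cE' ui uj vi vj nfi nfj Pi Pj)
        |exact: (same _ _ _ _ _ _ _ _ jI kI jk cE uj uk vj vk nfj nfk Pj Pk)
        |exact: (same _ _ _ _ _ _ _ _ jI kI jk cE' uj uk vj vk nfj nfk Pj Pk)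
        |exact: (same _ _ _ _ _ _ _ _ iI kI ik cE ui uk vi vk nfi nfk Pi Pk)
        |exact: (same _ _ _ _ _ _ _ _ iI kI ik cE' ui uk vi vk nfi nfk Pi Pk)].
Qed.

(** Let [{f, g}] be the 2-edge cut around the pendant part [B] of [c]. Any [i] in [I] other than [g]
    works; a third cut edge [h] provides the subgraph [M] through [f] and [g] that avoids [i]. *)
Lemma pendant_reducible E S e1 e2 I c : tec E -> side E S e1 -> side E (~: S) e2 ->
  (forall i, i \in I -> i \in E /\ crosses S i) -> 2 < #|I| ->
  c \in KI E S e1 e2 I -> c \subset S -> c \notin core E S e1 ->
  (forall i, i \in I -> ~~ eqv (KI E S e1 e2 I) c i) ->
  reducible E S e1 e2 I c.
Proof.
move=> tE sd1 sd2 IE I3 cF cS cL nci; set F := KI E S e1 e2 I in cF nci *.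
have FE : F \subset E by apply: KI_sub.
have tF : tec F := KI_tec _ _ _ _ _.
have F2 f : f \in F -> #|f| = 2 by apply: tec2.
have [e1F e2F IF] := KI_mem tE sd1 sd2 IE (ltnW I3).
have [B [f [g [[BS cB eB] [fE fS fB] [gE gS gB] cutB]]]] := pendant tE sd1 (subsetP FE _ cF) cS cL.
have eB' : ~~ (e1 \subset B) by move: eB; edge_cases (F2 _ e1F).
have [fF gF fg] := tec_cap_other tF FE cF e1F cB eB' cutB.
have gI : g \in I := KI_cross gF gS.
have ncg : ~~ eqv F c g := nci _ gI.
have ncf : ~~ eqv F c f by apply: contra ncg => cf; apply: eqv_trans cf fg.
have cB' : c \subset B.
  have [cB1|/(ncrosses_side (F2 _ cF))] := boolP (crosses B c); last by rewrite (negbTE cB) orbF.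
  by case: (cutB c (subsetP FE _ cF) cB1) => E'; [move: ncf | move: ncg]; rewrite -E' eqv_refl.
have /card_gt1P [i [h [iI' hI' ih]]] : 1 < #|I :\ g| by move: I3; rewrite (cardsD1 g I) gI.
move: iI' hI'; rewrite !inE => /andP [ig iI] /andP [hg hI].
have [[iE iS] [hE hS]] := (IE _ iI, IE _ hI).
have iF := subsetP IF _ iI.
pose M := KI E S e1 e2 [set g; h].
have gh : g != h by rewrite eq_sym.
have [e1M e2M gM hM] := KI_pair tE sd1 sd2 gE hE gS hS gh.
have tM : tec M := KI_tec _ _ _ _ _.
have MF : M \subset F by apply: KIS; rewrite subset2 gI.
have fM : f \in M by apply: eqv_mem tM MF gM; rewrite eqv_sym.
have iM : i \notin M.
  by apply/negP => /KI_cross /(_ iS); rewrite !inE (negbTE ig) (negbTE ih).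
have igF : ~~ eqv F i g by apply: contra iM => ig'; apply: eqv_mem tM MF gM; rewrite eqv_sym.
have iB : i \subset ~: B.
  have niB : ~~ crosses B i.
    apply/negP => /(cutB i iE) [] E'; last by rewrite E' eqxx in ig.
    by move: (sub_ncrosses (F2 _ fF) fS); rewrite -E' iS.
  case/orP: (ncrosses_side (F2 _ iF) niB) => // iB.
  by move: (sub_ncrosses (F2 _ iF) (subset_trans iB BS)); rewrite iS.
have I'2 : 1 < #|I :\ i| by move: I3; rewrite (cardsD1 i I) iI.
have IE' j : j \in I :\ i -> j \in E /\ crosses S j by rewrite inE => /andP [_ /IE].
have [e1F' e2F' _] := KI_mem tE sd1 sd2 IE' I'2.
set F' := KI E S e1 e2 (I :\ i) in e1F' e2F'.
have F'F : F' \subset F by apply: KIS; apply: subD1set.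
(* Otherwise a 2-edge cut [{i, d}] around some [A] separates [c] from [e1] and from all of [M]; then
   only [d] can leave [A :&: B], which separates [c] from [e1]. *)
have cF' : c \in F'.
  have ci : c != i by apply: contraNneq (nci _ iI) => ->; apply: eqv_refl.
  have e1i : e1 != i by apply: contraNneq iM => <-.
  have [[H [tH HF cH e1H iH]]|[A [d [cA eA [[_ dF iA dA id] cutA]]]]] := tec_or_two_cut tF cF e1F ci e1i.
    apply: (subsetP (KI_join e1F' e2F' tH _ e1H e1F')) => //.
    apply/subsetP => y yH; have yF := subsetP HF _ yH.
    apply: cutIP => [|yS]; first exact: (subsetP FE).
    rewrite in_setD1 (KI_cross yF yS) andbT; by apply: contraNneq iH => <-.
  exfalso.
  have dM : d \notin M by apply: contra iM; apply: eqv_mem tM MF; rewrite eqv_sym.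
  have MA y : y \in M -> y \subset ~: A.
    move=> yM; apply: (tec_out tM _ e1M eA yM) => z zM; apply/negP => zA.
    by case: (cutA z (subsetP MF _ zM) zA) => E'; [rewrite -E' zM in iM | rewrite -E' zM in dM].
  have cA' : c \subset A.
    have [cA1|/(ncrosses_side (F2 _ cF))] := boolP (crosses A c); last by rewrite (negbTE cA) orbF.
    case: (cutA c cF cA1) => E'; first by rewrite E' eqxx in ci.
    by move: (nci _ iI); rewrite eqv_sym E' id.
  have [y [yF yAB yd]] : exists y, [/\ y \in F, crosses (A :&: B) y & y != d].
    apply: (tec_cross d tF cF e1F).
      by move: cA' cB'; edge_cases (F2 _ cF).
    by move: eB; edge_cases (F2 _ e1F).
  have [yB|yB] := boolP (crosses B y).
    have yM : y \in M by case: (cutB y (subsetP FE _ yF) yB) => ->.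
    by move: yAB (MA _ yM); edge_cases (F2 _ yF).
  have yA : crosses A y by move: yAB yB; edge_cases (F2 _ yF).
  case: (cutA y yF yA) => E'; last by rewrite E' eqxx in yd.
  by subst y; move: yAB iB; edge_cases (F2 _ yF).
exists i; split=> // f' f'F' cf'; apply/negPn/negP => ncf'.
(* The set [A] splits [B] into [A :&: B] and [B :\: A], each left by exactly one of [f] and [g].
   This forces [f'] inside [B]; then [A :\: B] is left by [i] and one of [f], [g] only, making [i]
   equivalent to [g]. *)
have [A [cA f'A iA cutA]] := three_cut tE iS e1F' e2F' cF' f'F' cf' ncf'.
have f'F := subsetP F'F _ f'F'.
have cP : crosses (A :&: B) c by move: cA cB'; edge_cases (F2 _ cF).
have cQ : crosses (B :\: A) c by move: cA cB'; edge_cases (F2 _ cF).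
have nfg y : y = f \/ y = g -> ~~ eqv F c y by case=> ->.
have cutAB y D : y \in F -> crosses D y -> (D = A :&: B \/ D = B :\: A) ->
    [\/ y = c, y = f' /\ f' \subset B | y = f \/ y = g].
  move=> yF yZ ZE; have [yB|yB] := boolP (crosses B y).
    by constructor 3; apply: cutB => //; apply: (subsetP FE).
  have yA : crosses A y.
    by case: ZE => E'; subst D; move: yZ yB; edge_cases (F2 _ yF).
  have yB' : y \subset B.
    by case: ZE => E'; subst D; move: yZ yB; edge_cases (F2 _ yF).
  case: (cutA y yF yA) => E'; subst y; [by constructor 1|by constructor 2|].
  by move: yB' iB; edge_cases (F2 _ yF).
(* If neither [f] nor [g] leaves [D], only [c] and possibly [f'] do, so [c] is a bridge of [F] or
   equivalent to [f']. *)
have crossFG D : crosses D c -> (D = A :&: B \/ D = B :\: A) ->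
    exists y, [/\ y = f \/ y = g, y \in F & crosses D y].
  move=> cZ ZE.
  have [/exists_inP [y yF /andP [yfg yZ]]|nex] :=
      boolP [exists y in F, ((y == f) || (y == g)) && crosses D y].
    by exists y; split=> //; case/orP: yfg => /eqP; [left|right].
  have noFG y : y \in F -> crosses D y -> y = c \/ y = f' /\ f' \subset B.
    move=> yF yZ; case: (cutAB y D yF yZ ZE) => [|| yfg]; [by left|by right|].
    case/negP: nex; apply/exists_inP; exists y => //; rewrite yZ andbT.
    by case: yfg => ->; rewrite eqxx ?orbT.
  have [z [zF zZ zc]] := tec_cross_other tF cF cZ.
  case: (noFG z zF zZ) => [E'|[E' f'B]]; first by rewrite E' eqxx in zc.
  case/negP: ncf'; subst z; apply: (cut_eqv cZ zZ) => y yF yZ.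
  by case: (noFG y yF yZ) => [|[]]; [left|right].
have [y [yfg yF yP]] := crossFG _ cP (or_introl erefl).
have [y' [y'fg y'F y'Q]] := crossFG _ cQ (or_intror erefl).
have yB : crosses B y by case: yfg => ->.
have y'B : crosses B y' by case: y'fg => ->.
have yy' : y != y'.
  by apply: contraTneq y'Q => <-; move: yB yP; edge_cases (F2 _ yF).
have fgE z : z = f \/ z = g -> z = y \/ z = y'.
  case: yfg yy' => ->; case: y'fg => ->; rewrite ?eqxx // => _ [] ->; by [left|right].
have eqy z : z = f \/ z = g -> eqv F z g by case=> ->; [|apply: eqv_refl].
have f'B : f' \subset B.
  apply/negPn/negP => f'B; case/negP: (nfg _ yfg); apply: (cut_eqv cP yP) => z zF zP.
  case: (cutAB z _ zF zP (or_introl erefl)) => [||/fgE []]; [by left | by case=> _; rewrite (negbTE f'B) | by right |].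
  by move=> E'; subst z; move: zP y'Q y'B; edge_cases (F2 _ zF).
have fgA z : z = f \/ z = g -> z \in F -> crosses B z -> ~~ crosses A z.
  move=> zfg zF zB; apply/negP => /(cutA z zF) [] E'; subst z.
  - by move: zB cB'; edge_cases (F2 _ zF).
  - by move: zB f'B; edge_cases (F2 _ zF).
  - by move: zB iB; edge_cases (F2 _ zF).
have yA : y \subset A by move: (fgA y yfg yF yB) yP; edge_cases (F2 _ yF).
have y'A : y' \subset ~: A by move: (fgA y' y'fg y'F y'B) y'Q; edge_cases (F2 _ y'F).
have yD : crosses (A :\: B) y by move: yA yB; edge_cases (F2 _ yF).
have cutD z : z \in F -> crosses (A :\: B) z -> z = y \/ z = i.
  move=> zF zD; have [zB|zB] := boolP (crosses B z).
    case: (fgE z (cutB z (subsetP FE _ zF) zB)); first by left.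
    by move=> E'; subst z; move: zD y'A; edge_cases (F2 _ zF).
  have zA : crosses A z by move: zD zB; edge_cases (F2 _ zF).
  case: (cutA z zF zA) => E'; subst z; last by right.
  - by move: zD cB'; edge_cases (F2 _ zF).
  - by move: zD f'B; edge_cases (F2 _ zF).
have [z [zF zD zy]] := tec_cross_other tF yF yD.
have iD : crosses (A :\: B) i by case: (cutD z zF zD) => E'; [rewrite E' eqxx in zy | rewrite -E'].
case/negP: igF; rewrite eqv_sym; apply: eqv_trans (cut_eqv yD iD cutD); rewrite eqv_sym.
exact: eqy.
Qed.

End Induction.

(** * Sufficiency of case (ii) *)

Section Sufficiency.
Variable T : finType.
Implicit Types (A B C S W f g h c d i j x y z e : {set T}) (E F G H K M N X Y Z I J : {set {set T}}).

Lemma reducibleC E S e1 e2 I c : tec E ->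
  reducible E (~: S) e2 e1 I c -> reducible E S e1 e2 I c.
Proof. by move=> tE [i]; rewrite !KIC //; exists i. Qed.

Lemma KI_reducible E S e1 e2 I c : tec E -> side E S e1 -> side E (~: S) e2 ->
  (forall i, i \in I -> i \in E /\ crosses S i) -> 2 < #|I| ->
  c \in KI E S e1 e2 I -> (forall i, i \in I -> ~~ eqv (KI E S e1 e2 I) c i) ->
  reducible E S e1 e2 I c.
Proof.
move=> tE sd1 sd2 IE I3 cF nci; have cE := subsetP (KI_sub _ _ _ _ _) _ cF.
have sd1' : side E (~: ~: S) e1 by rewrite setCK.
have IE' i : i \in I -> i \in E /\ crosses (~: S) i.
  by move=> /IE [iE iS]; rewrite crossesC // (tec2 tE iE).
have [cL1|cL1] := boolP (c \in core E S e1); first exact: core_reducible.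
have [cL2|cL2] := boolP (c \in core E (~: S) e2).
  by apply: reducibleC => //; apply: core_reducible.
have ncS : ~~ crosses S c.
  by apply/negP => cS; move: (nci c (KI_cross cF cS)); rewrite eqv_refl.
case/orP: (ncrosses_side (tec2 tE cE) ncS) => cS; first exact: pendant_reducible.
apply: reducibleC => //; apply: pendant_reducible => //; rewrite KIC //.
Qed.

Variables (R : numDomainType) (a : {set T} -> R).
Local Open Scope ring_scope.

Section Tight.
Variables (E : {set {set T}}) (S e1 e2 : {set T}).
Hypotheses (tE : tec E) (sd1 : side E S e1) (sd2 : side E (~: S) e2).
Hypothesis a1 : forall H, tec H -> e1 \in H -> H \subset core E S e1 -> wt a H = 0.
Hypothesis a2 : forall H, tec H -> e2 \in H -> H \subset core E (~: S) e2 -> wt a H = 0.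
Hypothesis a12 : forall H g h, tec H -> H \subset E -> e1 \in H -> e2 \in H -> g != h ->
  g \in H -> h \in H -> crosses S g -> crosses S h ->
  (forall f, f \in H -> crosses S f -> f = g \/ f = h) -> wt a H = 0.

(** Subgraphs of K_{g,h} through [e1] and [e2] contain both cut edges and are tight. Classes in the
    cores vanish by [core_cls0]; the others, except that of [g], are avoided by a union of one
    subgraph for each shore, joined at [g]; the class of [g] is the rest. *)
Lemma pair_cls0 g h c : g \in E -> h \in E -> crosses S g -> crosses S h -> g != h ->
  c \in KI E S e1 e2 [set g; h] -> wt a (cls (KI E S e1 e2 [set g; h]) c) = 0.
Proof.
move=> gE hE gS hS gh; set F := KI _ _ _ _ _ => cF.
have FE : F \subset E by apply: KI_sub.
have tF : tec F := KI_tec _ _ _ _ _.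
have F2 f : f \in F -> #|f| = 2%N by apply: tec2.
have [e1F e2F gF hF] := KI_pair tE sd1 sd2 gE hE gS hS gh.
have L1F : core E S e1 \subset F by apply: core_KI.
have L2F : core E (~: S) e2 \subset F.
  by rewrite /F -KIC //; apply: core_KI => //; rewrite KIC.
have cutF f : f \in F -> crosses S f -> f = g \/ f = h.
  by move=> fF fS; move: (KI_cross fF fS); rewrite !inE => /orP [] /eqP; [left|right].
have gh' : eqv F g h by apply: (cut_eqv gS hS cutF).
have tight H : tec H -> e1 \in H -> e2 \in H -> H \subset F -> wt a H = 0.
  move=> tH e1H e2H HF.
  have [_ e1S _ _ _] := sd1; have [_ e2S _ _ _] := sd2.
  have nS1 : ~~ (e1 \subset ~: S) by apply: sub_nsubC e1S; apply: F2.
  have nS2 : ~~ (e2 \subset S) by rewrite -[S]setCK; apply: sub_nsubC e2S; apply: F2.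
  have [z [zH zS _]] := tec_cross set0 tH e1H e2H nS1 nS2.
  have gH : g \in H.
    case: (cutF z (subsetP HF _ zH) zS) => E'; subst z => //.
    by apply: eqv_mem tH HF zH; rewrite eqv_sym.
  apply: (a12 tH (subset_trans HF FE) e1H e2H gh gH (eqv_mem gh' tH HF gH) gS hS).
  by move=> f fH; apply: cutF; apply: (subsetP HF).
have nonchain x : x \in F -> ~~ eqv F g x -> wt a (cls F x) = 0.
  move=> xF ngx; have nxg : ~~ eqv F x g by rewrite eqv_sym.
  have [xL|xL] := boolP (x \in core E S e1).
    exact: (core_cls0 tE sd1 sd2 tF FE L1F L2F gF hF gS hS cutF a1 tight).
  have gS' : crosses (~: S) g by rewrite crossesC // F2.
  have hS' : crosses (~: S) h by rewrite crossesC // F2.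
  have cutF' f : f \in F -> crosses (~: S) f -> f = g \/ f = h.
    by move=> fF; rewrite crossesC ?F2 //; apply: cutF.
  have [xL2|xL2] := boolP (x \in core E (~: S) e2).
    apply: (@core_cls0 _ _ a E (~: S) e2 e1 F g h) => //; rewrite ?setCK //.
    by move=> H tH e2H e1H; apply: tight.
  have [M [tM MF gM e1M xM]] := core_avoid tE sd1 tF FE L1F gF hF gS hS cutF xF xL nxg.
  have [M' [tM' MF' gM' e2M' xM']] := core_avoid tE sd2 tF FE L2F gF hF gS' hS' cutF' xF xL2 nxg.
  apply: (@wt_cls_eq0 _ _ a F [set e1; e2] e1) => //.
  - by rewrite !inE eqxx.
  - by rewrite subset2 e1F.
  - by move=> H tH; rewrite subset2 => /andP [? ?]; apply: tight.
  - exists (M :|: M'); rewrite (tecU1 tM tM' gM gM') subset2 !inE e1M e2M' orbT.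
    by rewrite subUset MF MF' negb_or xM xM'.
have [gc|] := boolP (eqv F g c); last exact: nonchain.
rewrite -(eq_cls gc) -(wt_closed1 (tec_closed tF (subxx F)) gF nonchain).
exact: tight.
Qed.

Lemma KI_cls0 I c : (forall i, i \in I -> i \in E /\ crosses S i) -> (1 < #|I|)%N ->
  c \in KI E S e1 e2 I -> (forall i, i \in I -> ~~ eqv (KI E S e1 e2 I) c i) ->
  wt a (cls (KI E S e1 e2 I) c) = 0.
Proof.
have [n] := ubnP #|I|; elim: n => // n IHn in I *; rewrite ltnS => leI IE I2 cF nci.
have [I3|I3] := ltnP 2 #|I|; last first.
  have /eqP/cards2P [g [h [gh E']]] : #|I| = 2%N by apply/eqP; rewrite eqn_leq I3.
  subst I; have [gE gS] : g \in E /\ crosses S g by apply: IE; rewrite !inE eqxx.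
  have [hE hS] : h \in E /\ crosses S h by apply: IE; rewrite !inE eqxx orbT.
  exact: pair_cls0.
have [i [iI cF' h]] := KI_reducible tE sd1 sd2 IE I3 cF nci.
set F := KI E S e1 e2 I in cF nci h *; set F' := KI E S e1 e2 (I :\ i) in cF' h.
have F'F : F' \subset F by apply: KIS; apply: subD1set.
have -> : cls F c = cls F' c.
  apply/setP => f; rewrite !inE; apply/andP/andP => [[fF cf]|[fF' cf]].
    have fF' : f \in F' by apply: eqv_mem cf (KI_tec _ _ _ _ _) F'F cF'.
    by split=> //; apply: eqv_sub cf.
  by split; [apply: (subsetP F'F) | apply: h].
have cI : #|I| = #|I :\ i|.+1 by rewrite (cardsD1 i I) iI.
have IE' j : j \in I :\ i -> j \in E /\ crosses S j by rewrite inE => /andP [_ /IE].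
have I'2 : (1 < #|I :\ i|)%N by rewrite -ltnS -cI.
apply: IHn => //; first by rewrite -cI.
move=> j; rewrite !inE => /andP [ji jI].
apply: contra (nci j jI) => cj; apply: h => //.
have [_ _ /subsetP] := KI_mem tE sd1 sd2 IE' I'2.
by apply; rewrite !inE ji.
Qed.

(** For three or more cut edges, K_{p,q} consists of the classes of [p] and [q] and of classes
    without cut edges, which vanish by [KI_cls0]. So any two chains have weights summing to zero. *)
Lemma tight_kills H : tec H -> H \subset E -> wt a H = 0.
Proof.
move: H; apply: wt_tec_eq0.
pose I := [set f in E | crosses S f].
have IE i : i \in I -> i \in E /\ crosses S i by rewrite inE => /andP.
have [e1E e1S _ _ _] := sd1; have [e2E e2S _ _ _] := sd2.
have nS1 : ~~ (e1 \subset ~: S) by apply: sub_nsubC e1S; apply: tec2 tE _.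
have nS2 : ~~ (e2 \subset S) by rewrite -[S]setCK; apply: sub_nsubC e2S; apply: tec2 tE _.
have KE : KI E S e1 e2 I = E.
  apply/eqP; rewrite eqEsubset KI_sub; apply: mtec_max => //; first by rewrite subset2 e1E.
  by apply/subsetP => f fE; apply: cutIP => // fS; rewrite inE fE.
have [g [gE gS _]] := tec_cross set0 tE e1E e2E nS1 nS2.
have [h0 [h0E h0S h0g]] := tec_cross g tE e1E e2E nS1 nS2.
have I2 : (1 < #|I|)%N by apply/card_gt1P; exists h0, g; rewrite !inE gE gS h0E h0S.
have [I3|I3] := ltnP 2 #|I|; last first.
  have /eqP/cards2P [p [q [pq IE']]] : #|I| = 2%N by apply/eqP; rewrite eqn_leq I3.
  have [pE pS] : p \in E /\ crosses S p by apply: IE; rewrite IE' !inE eqxx.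
  have [qE qS] : q \in E /\ crosses S q by apply: IE; rewrite IE' !inE eqxx orbT.
  by move=> c; rewrite -KE IE'; apply: pair_cls0.
have nonchain c : c \in E -> (forall i, i \in I -> ~~ eqv E c i) -> wt a (cls E c) = 0.
  by move=> cE nci; rewrite -KE; apply: KI_cls0; rewrite // KE.
have pairS p q : p \in I -> q \in I -> p != q -> wt a (cls E p) + wt a (cls E q) = 0.
  move=> pI qI pq; have [[pE pS] [qE qS]] := (IE _ pI, IE _ qI).
  pose F := KI E S e1 e2 [set p; q].
  have FE : F \subset E by apply: KI_sub.
  have tF : tec F := KI_tec _ _ _ _ _.
  have [e1F _ pF qF] := KI_pair tE sd1 sd2 pE qE pS qS pq.
  have clF := tec_closed tF FE.
  have [r [rI rp rq]] : exists r, [/\ r \in I, r != p & r != q].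
    have /card_gt0P [r] : (0 < #|I :\ p :\ q|)%N.
      by move: I3; rewrite (cardsD1 p I) pI (cardsD1 q (I :\ p)) in_setD1 qI eq_sym pq.
    by case/setD1P => rq /setD1P [rp rI]; exists r.
  have [rE rS] := IE _ rI.
  (* K_{p,r} contains [p] but not [q]. *)
  have npq : ~~ eqv E p q.
    have pr : p != r by rewrite eq_sym.
    have [_ _ pF' _] := KI_pair tE sd1 sd2 pE rE pS rS pr.
    apply/negP => E'; have := eqv_mem E' (KI_tec _ _ _ _ _) (KI_sub _ _ _ _ _) pF'.
    by move/KI_cross/(_ qS); rewrite !inE eq_sym (negbTE pq) eq_sym (negbTE rq).
  have F0 : wt a F = 0.
    apply: (wt_closed0 (tec_closed tF (subxx F))) => f; exact: pair_cls0.
  rewrite -F0 (wtD a (cls_sub_closed clF pF)); congr (_ + _); symmetry.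
  apply: wt_closed1; first exact: closedD.
    by rewrite in_setD qF andbT inE qE npq.
  move=> f; rewrite 2!inE negb_and => /andP [npf fF] nqf.
  have fE := subsetP FE _ fF; rewrite fE /= in npf.
  apply: nonchain => // i iI; apply/negP => fi.
  have [iE iS] := IE _ iI; move: (eqv_mem fi tF FE fF) => /KI_cross/(_ iS).
  rewrite !inE => /orP [] /eqP E'; subst i; rewrite eqv_sym in fi.
    by rewrite fi in npf.
  by rewrite fi in nqf.
move=> c cE.
have [/exists_inP [i iI ci]|nex] := boolP [exists i in I, eqv E c i]; last first.
  apply: nonchain => // i iI; apply: contra nex => ci; by apply/exists_inP; exists i.
rewrite (eq_cls ci).
have /card_gt1P [j [k [jI' kI' jk]]] : (1 < #|I :\ i|)%N by move: I3; rewrite (cardsD1 i I) iI.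
move: jI' kI'; rewrite ![_ \in I :\ i]in_setD1 => /andP [ji jI] /andP [ki kI].
have E1 := pairS _ _ jI iI ji; have E2 := pairS _ _ kI iI ki; have E3 := pairS _ _ jI kI jk.
(* Twice the weight of one chain is a combination of the pairwise sums of three chains. *)
have : wt a (cls E i) *+ 2 = 0.
  have -> : wt a (cls E i) *+ 2 = (wt a (cls E j) + wt a (cls E i)) + (wt a (cls E k) + wt a (cls E i))
     - (wt a (cls E j) + wt a (cls E k)).
    by rewrite addrACA [RHS]addrC addKr mulr2n.
  by rewrite E1 E2 E3 addr0 subr0.
by move/eqP; rewrite mulrn_eq0 => /eqP.
Qed.

End Tight.
End Sufficiency.

(** * Facets and annihilators *)

Section Facets.
Variables (T : finType) (R : realType) (E : {set {set T}}).
Local Open Scope ring_scope.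
Implicit Types (D : pred {set {set T}}) (F : {set {set T}}) (x : vec T R).

Definition chi F : vec T R := fun f => (f \in F)%:R.

(** Coordinates outside [E] are zeroed, so that vectors agreeing on [E] have the same row. *)
Definition rowv x : 'rV[R]_#|{: {set T}}| :=
  \row_j (if enum_val j \in E then x (enum_val j) else 0).

(** Its row space is the span of the incidence vectors of the members of [D]; the other edge sets
    contribute zero rows. *)
Definition mxv D : 'M[R]_(#|{: {set {set T}}}|, #|{: {set T}}|) :=
  \matrix_i (if D (enum_val i) then rowv (chi (enum_val i)) else 0).

Lemma eq_rowv x y : {in E, x =1 y} -> rowv x = rowv y.
Proof. by move=> xy; apply/rowP => j; rewrite !mxE; case: ifP => // /xy. Qed.

Lemma rowv_mul x (a : {set T} -> R) :
  \sum_j rowv x 0 j * a (enum_val j) = \sum_(f in E) x f * a f.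
Proof.
rewrite [RHS]big_mkcond [RHS](reindex (fun j : 'I_#|{: {set T}}| => enum_val j)) /=; last by apply: onW_bij; apply: enum_val_bij.
by apply: eq_bigr => j _; rewrite mxE; case: ifP; rewrite // mul0r.
Qed.

Lemma rowv_sum k (c : 'I_k -> R) (v : 'I_k -> vec T R) :
  rowv (fun f => \sum_i c i * v i f) = \sum_i c i *: rowv (v i).
Proof.
apply/rowP => j; rewrite summxE mxE; case: ifP => Ej.
  by apply: eq_bigr => i _; rewrite !mxE Ej.
by rewrite big1 // => i _; rewrite !mxE Ej mulr0.
Qed.

Lemma rowvB x y : rowv (fun f => x f - y f) = rowv x - rowv y.
Proof. by apply/rowP => j; rewrite !mxE; case: ifP => _; rewrite ?subr0. Qed.

Lemma rowv_eq0 x : rowv x = 0 <-> {in E, forall f, x f = 0}.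
Proof.
split=> [/rowP h f fE|h]; last by apply/rowP => j; rewrite !mxE; case: ifP => // /h.
by move: (h (enum_rank f)); rewrite !mxE enum_rankK fE.
Qed.

Lemma rowv_chi_sub D F : D F -> (rowv (chi F) <= mxv D)%MS.
Proof.
move=> DF; have -> : rowv (chi F) = row (enum_rank F) (mxv D).
  by rewrite rowK enum_rankK DF.
exact: row_sub.
Qed.

Lemma mulmx_rowv k (c : 'rV[R]_k) (v : 'I_k -> vec T R) :
  c *m (\matrix_i rowv (v i)) = rowv (fun f => \sum_i c 0 i * v i f).
Proof. by rewrite mulmx_sum_row rowv_sum; apply: eq_bigr => i _; rewrite rowK. Qed.

Lemma lin_indepP k (v : 'I_k -> vec T R) :
  lin_indep E v <-> row_free (\matrix_i rowv (v i)).
Proof.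
split=> [h|fr c hc i].
  apply: inj_row_free => c; rewrite mulmx_rowv => /rowv_eq0 /h c0.
  by apply/rowP => i; rewrite c0 mxE.
have c0 : (\row_i c i) = 0 :> 'rV_k.
  apply: (row_free_inj fr); rewrite /= mul0mx mulmx_rowv; apply/rowv_eq0 => f fE.
  by rewrite -[RHS](hc f fE); apply: eq_bigr => j _; rewrite mxE.
by move/rowP/(_ i): c0; rewrite !mxE.
Qed.

Lemma rowsub_free m n k (A : 'M[R]_(m, n)) (g : 'I_k -> 'I_m) :
  injective g -> row_free A -> row_free (rowsub g A).
Proof.
move=> gi fr; apply: inj_row_free => v; rewrite rowsubE mulmxA => h.
have : v *m rowsub g 1%:M = 0 by apply: (row_free_inj fr); rewrite /= mul0mx.
move/rowP => h'; apply/rowP => i; move: (h' (g i)); rewrite !mxE => <-.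
rewrite (bigD1 i) //= !mxE eqxx mulr1 big1 ?addr0 // => j ji.
by rewrite !mxE (inj_eq gi) (negbTE ji) mulr0.
Qed.

(** The rows selected by [maxrankfun] are independent, hence nonzero, hence come from members of
    [D]. *)
Lemma pick_indep D k : (k <= \rank (mxv D))%N ->
  exists F : 'I_k -> {set {set T}}, (forall i, D (F i)) /\ lin_indep E (fun i => chi (F i)).
Proof.
move=> lek; pose g i := maxrankfun (mxv D) (widen_ord lek i).
have gi : injective (widen_ord lek) by move=> i j /(congr1 val) /= /val_inj.
have fr := rowsub_free gi (maxrowsub_free (mxv D)).
have DF i : D (enum_val (g i)).
  apply/negPn/negP => nD.
  have : delta_mx 0 i *m rowsub (widen_ord lek) (rowsub (maxrankfun (mxv D)) (mxv D)) = 0 :> 'rV_ _.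
    rewrite -rowE; apply/rowP => j; rewrite !mxE /= -/(g i) (negbTE nD) mxE //.
  move=> /(etrans _) h; have /(row_free_inj fr) : delta_mx 0 i *m rowsub (widen_ord lek) (rowsub (maxrankfun (mxv D)) (mxv D))
      = 0 *m rowsub (widen_ord lek) (rowsub (maxrankfun (mxv D)) (mxv D)) :> 'rV_ _.
    by rewrite mul0mx; apply: h.
  by move/rowP/(_ i); rewrite !mxE !eqxx => /eqP; rewrite oner_eq0.
exists (fun i => enum_val (g i)); split=> //.
apply/lin_indepP; congr (row_free _): fr.
by apply/row_matrixP => i; rewrite rowK; apply/rowP => j; rewrite !mxE -/(g i) DF !mxE.
Qed.

Lemma conv_rowv_sub D n (p : 'I_n -> vec T R) (w : 'I_n -> R) x :
  (forall i, w i != 0 -> exists2 F, D F & {in E, p i =1 chi F}) ->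
  (forall f, f \in E -> x f = \sum_(i < n) w i * p i f) -> (rowv x <= mxv D)%MS.
Proof.
move=> h xE; rewrite (eq_rowv xE) rowv_sum summx_sub // => i _.
have [->|wi] := eqVneq (w i) 0; first by rewrite scale0r sub0mx.
have [F DF pF] := h i wi; rewrite (eq_rowv pF); apply: scalemx_sub.
exact: rowv_chi_sub.
Qed.

Variables (Q : vec T R -> Prop) (P : pred {set {set T}}).
Hypothesis QP : forall y, Q y <-> exists2 F, P F & {in E, y =1 chi F}.
Hypothesis P0 : P set0.

Lemma chiQ F : P F -> Q (chi F).
Proof. by move=> PF; apply/QP; exists F. Qed.

Lemma conv_vertex x : Q x -> conv E Q x.
Proof.
move=> Qx; exists 1%N, (fun=> x), (fun=> 1).
by do !split=> //; rewrite ?big_ord1 // => f fE; rewrite big_ord1 mul1r.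
Qed.

(** The origin is the incidence vector of [set0], so the affine dimension is that of the linear
    span. *)
Lemma affdim_conv k : affdim_ge E (conv E Q) k <-> (k <= \rank (mxv P))%N.
Proof.
split=> [[p [pQ /lin_indepP]]|lek].
  rewrite /row_free => /eqP <-; apply: mxrankS; apply/row_subP => i; rewrite rowK rowvB.
  have sub j : (rowv (p j) <= mxv P)%MS.
    have [n [q [w [hq [_ [_ xE]]]]]] := pQ j; apply: conv_rowv_sub xE => l _.
    exact/QP.
  by rewrite addmx_sub // eqmx_opp.
have [F [PF li]] := pick_indep lek.
exists (fun i => if unlift ord0 i is Some j then chi (F j) else chi set0); split.
  by move=> i; apply: conv_vertex; case: unliftP => [j _|_]; apply: chiQ.
move=> c hc; apply: li => f fE; rewrite -[RHS](hc f fE); apply: eq_bigr => i _.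
by rewrite liftK unlift_none /chi inE subr0.
Qed.

Variables (l : {set T} -> R) (b : R).
Hypothesis b0 : b != 0.
Let lhs x := \sum_(f in E) l f * x f.

Lemma lhs_sum k (c : 'I_k -> R) (v : 'I_k -> vec T R) x :
  {in E, forall f, x f = \sum_i c i * v i f} -> lhs x = \sum_i c i * lhs (v i).
Proof.
move=> h; rewrite /lhs.
under eq_bigr => f fE do rewrite h // mulr_sumr.
rewrite exchange_big; apply: eq_bigr => i _; rewrite mulr_sumr.
by apply: eq_bigr => f _; rewrite mulrCA.
Qed.

Lemma eq_lhs x y : {in E, x =1 y} -> lhs x = lhs y.
Proof. by move=> h; apply: eq_bigr => f /h ->. Qed.

Hypothesis valid : forall F, P F -> lhs (chi F) <= b.

Definition tight F := P F && (lhs (chi F) == b).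

Lemma valid_conv x : conv E Q x -> lhs x <= b.
Proof.
move=> [n [q [w [hq [w0 [w1 xE]]]]]]; rewrite (lhs_sum xE).
rewrite -[b]mul1r -w1 mulr_suml; apply: ler_sum => i _; apply: ler_wpM2l => //.
by have /QP [F PF qF] := hq i; rewrite (eq_lhs qF) valid.
Qed.

(** A convex combination attaining the bound gives positive weight only to vectors attaining it. *)
Lemma face_rowv_sub x : conv E Q x -> lhs x = b -> (rowv x <= mxv tight)%MS.
Proof.
move=> [n [q [w [hq [w0 [w1 xE]]]]]]; rewrite (lhs_sum xE) => lb.
apply: conv_rowv_sub xE => i wi; have /QP [F PF qF] := hq i; exists F => //.
rewrite /tight PF -(eq_lhs qF) /=.
have le j : w j * lhs (q j) <= w j * b.
  by apply: ler_wpM2l => //; have /QP [G PG qG] := hq j; rewrite (eq_lhs qG) valid.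
have /eqP : \sum_j (w j * b - w j * lhs (q j)) = 0.
  by rewrite sumrB lb -mulr_suml w1 mul1r subrr.
rewrite psumr_eq0 => [/allP /(_ i)|j _]; last by rewrite subr_ge0.
rewrite mem_index_enum => /(_ isT) /=; rewrite subr_eq0 => /eqP /(mulfI wi) ->.
by [].
Qed.

Let face x := conv E Q x /\ lhs x = b.

(** As [b] is nonzero the hyperplane misses the origin, so affinely independent points of the face
    are linearly independent; hence the shift by one against [affdim_conv]. *)
Lemma affdim_face k : affdim_ge E face k <-> (k < \rank (mxv tight))%N.
Proof.
split=> [[p [pf ai]]|lek].
  have /lin_indepP : lin_indep E p.
    move=> c hc.
    have c0 : \sum_i c i = 0.
      have e0 : lhs (fun=> 0) = \sum_i c i * lhs (p i) by apply: lhs_sum => f /hc ->.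
      have : (\sum_i c i) * b = lhs (fun=> 0).
        by rewrite e0 mulr_suml; apply: eq_bigr => i _; have [_ ->] := pf i.
      rewrite /lhs [X in _ = X]big1 => [/eqP|f _]; last by rewrite mulr0.
      by rewrite mulf_eq0 (negbTE b0) orbF => /eqP.
    have cl i : c (lift ord0 i) = 0.
      apply: (ai (fun i => c (lift ord0 i))) => f fE.
      under eq_bigr => j _ do rewrite mulrBr.
      rewrite sumrB -mulr_suml; move: (hc f fE) c0.
      rewrite !big_ord_recl => h1 /eqP; rewrite addr_eq0 => /eqP h2.
      by move: h1; rewrite h2 mulNr addrC.
    move: c0; rewrite big_ord_recl big1 ?addr0 => [c0 i|j _]; last exact: cl.
    by have [j ->|->] := unliftP ord0 i.
  rewrite /row_free => /eqP <-; apply: mxrankS; apply/row_subP => i; rewrite rowK.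
  by have [? ?] := pf i; apply: face_rowv_sub.
have [F [tF li]] := pick_indep lek.
exists (fun i => chi (F i)); split=> [i|c hc].
  by have /andP [PF /eqP lF] := tF i; split=> //; apply: conv_vertex; apply: chiQ.
(* Coefficients of the differences become coefficients of the points, the base point receiving minus
   their sum. *)
pose c' i := if unlift ord0 i is Some j then c j else - \sum_j c j.
have c'0 : forall i, c' i = 0.
  apply: li => f fE; rewrite big_ord_recl.
  have -> : c' ord0 = - \sum_j c j by rewrite /c' unlift_none.
  have -> : \sum_(i < k) c' (lift ord0 i) * chi (F (lift ord0 i)) f =
      \sum_(i < k) c i * chi (F (lift ord0 i)) f.
    by apply: eq_bigr => i _; rewrite /c' liftK.
  rewrite -[RHS](hc f fE) mulNr mulr_suml addrC -sumrB.
  by apply: eq_bigr => j _; rewrite mulrBr.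
by move=> i; move: (c'0 (lift ord0 i)); rewrite /c' liftK.
Qed.

Lemma facet_rank : defines_facet E (conv E Q) lhs b <-> \rank (mxv tight) = \rank (mxv P).
Proof.
have tP : (\rank (mxv tight) <= \rank (mxv P))%N.
  apply: mxrankS; apply/row_subP => i; rewrite rowK; case: ifP => [/andP [PF _]|_].
    exact: rowv_chi_sub.
  exact: sub0mx.
split=> [[_ [d [hd hf]]]|tr].
  have dE : d = (\rank (mxv P))%:Z.
    case: hd => [[_ /(_ (chi set0))]|[n [-> [/affdim_conv n1 n2]]]].
      by case; apply: conv_vertex; apply: chiQ.
    congr (Posz _); apply/eqP; rewrite eqn_leq n1 /= leqNgt; apply/negP => n3.
    by apply: n2; apply/affdim_conv.
  apply/eqP; rewrite eqn_leq tP /=.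
  case: hf => [[d1 _]|[n [dn [/affdim_face n1 _]]]].
    move: d1; rewrite dE => /eqP; rewrite -subr_eq0 opprK subrK => /eqP [->].
    by [].
  have -> : \rank (mxv P) = n.+1; last by [].
  by apply/eqP; rewrite -eqz_nat -dE -[d](subrK 1) dn -PoszD addn1.
split; first exact: valid_conv.
exists (\rank (mxv P))%:Z; split.
  right; exists (\rank (mxv P)); split=> //; split; first exact/affdim_conv.
  by move/affdim_conv; rewrite ltnn.
(* In rank zero the polytope is the origin and the face is empty, of dimension -1. *)
case E0: (\rank (mxv P)) => [|r].
  left; split=> // x fx; have /affdim_face : affdim_ge E face 0.
    by exists (fun=> x); split=> // c _ [].
  by rewrite tr E0.
right; exists r; split; first by rewrite -addn1 PoszD addrK.
split; first by apply/affdim_face; rewrite tr E0.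
by move/affdim_face; rewrite tr E0 ltnn.
Qed.

Hypothesis PE : forall F, P F -> F \subset E.

Lemma sum_chi F (a : {set T} -> R) : F \subset E ->
  \sum_j rowv (chi F) 0 j * a (enum_val j) = \sum_(f in F) a f.
Proof.
move=> FE; rewrite rowv_mul [RHS]big_mkcond [LHS]big_mkcond /=; apply: eq_bigr => f _.
rewrite /chi; case fF: (f \in F); last by rewrite mul0r; case: ifP.
by rewrite (subsetP FE) // mul1r.
Qed.

(** One row space contains the other, so equal ranks mean equal row spaces, and these are compared
    through their annihilators. Columns of [cokermx] supply the functionals that vanish on the tight
    vectors. *)
Lemma facetP : defines_facet E (conv E Q) lhs b <->
  forall a : {set T} -> R, (forall F, tight F -> \sum_(f in F) a f = 0) ->
    forall F, P F -> \sum_(f in F) a f = 0.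
Proof.
rewrite facet_rank.
have tsub : (mxv tight <= mxv P)%MS.
  apply/row_subP => i; rewrite rowK; case: ifP => [/andP [PF _]|_].
    exact: rowv_chi_sub.
  exact: sub0mx.
have := mxrank_leqif_sup tsub => /leqifP; case: ifP => [sub /eqP tr|nsub lt].
  split=> // _ a ha F PF.
  have /submxP [u uE] : (rowv (chi F) <= mxv tight)%MS.
    exact: submx_trans (rowv_chi_sub PF) sub.
  rewrite -(sum_chi a (PE PF)).
  have -> : \sum_j rowv (chi F) 0 j * a (enum_val j)
     = (rowv (chi F) *m (\col_j a (enum_val j))) 0 0.
    by rewrite mxE; apply: eq_bigr => j _; rewrite [X in _ = _ * X]mxE.
  rewrite uE -mulmxA (_ : mxv tight *m _ = 0) ?mulmx0 ?mxE //.
  apply/colP => i; rewrite [RHS]mxE mxE.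
  have -> : \sum_j mxv tight i j * (\col_j a (enum_val j)) j 0 =
     if tight (enum_val i) then \sum_j rowv (chi (enum_val i)) 0 j * a (enum_val j) else 0.
    case: ifP => ti; first by apply: eq_bigr => j _; rewrite !mxE ti !mxE.
    by apply: big1 => j _; rewrite !mxE ti !mxE mul0r.
  by case: ifP => // ti; rewrite sum_chi ?ha //; apply: PE; case/andP: ti.
split=> [tr|h]; first by rewrite tr ltnn in lt.
case/negP: (negbT nsub); rewrite submxE; apply/eqP/matrixP => i k; rewrite [RHS]mxE.
pose a f := cokermx (mxv tight) (enum_rank f) k.
have rowE F : \sum_j rowv (chi F) 0 j * a (enum_val j) = (rowv (chi F) *m cokermx (mxv tight)) 0 k.
  by rewrite mxE; apply: eq_bigr => j _; rewrite /a enum_valK.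
have a0 F : tight F -> \sum_(f in F) a f = 0.
  move=> tF; rewrite -sum_chi; last by apply: PE; case/andP: tF.
  rewrite rowE; have := rowv_chi_sub tF; rewrite submxE => /eqP ->.
  by rewrite mxE.
have -> : (mxv P *m cokermx (mxv tight)) i k = row i (mxv P *m cokermx (mxv tight)) 0 k.
  by rewrite [RHS]mxE.
rewrite row_mul rowK; case: ifP => [Pi|_]; last by rewrite mul0mx mxE.
by rewrite -rowE sum_chi ?h //; apply: PE.
Qed.

End Facets.

(** * Components, bridges and cuts *)

Section Translation.
Variable T : finType.
Implicit Types (A B C D S W f g h c d i j x y z e : {set T}) (E F G H K M N X Y Z I J : {set {set T}}).

Lemma adj_connect_sym F : connect_sym (adj F).
Proof. by apply: sym_connect_sym => u v; rewrite /adj setUC. Qed.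

Lemma connect_cross F A u v : connect (adj F) u v -> u \in A -> v \notin A ->
  exists f, f \in F /\ crosses A f.
Proof.
case/connectP => p; elim: p => [|w p IHp] in u *; first by move=> _ -> ->.
move=> /= /andP [uw pw] vE uA vA; have [wA|wA] := boolP (w \in A).
  exact: IHp pw vE wA vA.
exists [set u; w]; split=> //; rewrite crosses2 ?uA ?(negbTE wA) //.
by apply: contraNneq wA => <-.
Qed.

Lemma connect_ncross F u p q f : f \in F -> f = [set p; q] -> connect (adj F) u p ->
  connect (adj F) u q.
Proof.
by move=> fF fE up; apply: connect_trans up _; apply: connect1; rewrite /adj -fE.
Qed.

Lemma comp_ncrosses F u f : #|f| = 2 -> f \in F -> ~~ crosses [set w | connect (adj F) u w] f.
Proof.
move=> f2 fF; apply/negP => /(crossesP f2) [p [q [fE]]]; rewrite !inE => up /negP.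
by apply; apply: connect_ncross fF fE up.
Qed.

Lemma comp_eq W F u v : connect (adj F) u v -> Defs.comp W F u = Defs.comp W F v.
Proof.
move=> uv; apply/setP => w; rewrite !inE; congr (_ && _).
exact: (same_connect (adj_connect_sym F) uv).
Qed.

(** In one direction [A] is the component of an end of [f] in [F] minus [f]. In the other,
    components of [F :\ f] map onto those of [F], and the two ends of [f] show that this map is not
    injective. *)
Lemma bridgeP W F f : simple F -> (forall y, y \in F -> y \subset W) ->
  reflect (f \in F /\ exists A, crosses A f /\ forall y, y \in F -> crosses A y -> y = f)
    (bridge W F f).
Proof.
move=> /simpleP s2 FW; apply: (iffP andP) => [[fF lt]|[fF [A [fA cutA]]]]; split=> //.
  have [u [v [uv fE]]] := edgeE (s2 _ fF).
  have [uvc|nuv] := boolP (connect (adj (F :\ f)) u v).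
    suff E' w : Defs.comp W F w = Defs.comp W (F :\ f) w.
      by move: lt; rewrite /ncomp (eq_imset _ E') ltnn.
    apply/setP => z; rewrite !inE; congr (_ && _); apply/idP/idP; apply: connect_sub => p q pq.
      case: (eqVneq [set p; q] f) => [E'|ne]; last by apply: connect1; rewrite /adj !inE ne.
      have /set2P pf : p \in [set u; v] by rewrite -fE -E' !inE eqxx.
      have /set2P qf : q \in [set u; v] by rewrite -fE -E' !inE eqxx orbT.
      case: pf qf => -> [] -> //; by rewrite adj_connect_sym.
    by apply: connect1; move: pq; rewrite /adj inE => /andP [].
  exists [set w | connect (adj (F :\ f)) u w]; split.
    by rewrite fE crosses2 // !inE -fE connect0 (negbTE nuv).
  move=> y yF; apply: contraTeq => yf; apply: comp_ncrosses (s2 _ yF) _.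
  by rewrite !inE yf.
have [u [v [fE uA vA]]] := crossesP (s2 _ fF) fA.
have [uW vW] : u \in W /\ v \in W.
  by split; apply: (subsetP (FW _ fF)); rewrite fE !inE eqxx ?orbT.
(* Sends a component of [F :\ f] to the component of [F] around it, by way of any of its points;
   [set0] is the value at the empty set only. *)
pose hh C := if [pick w in C] is Some w then Defs.comp W F w else set0.
have hE w : w \in W -> hh (Defs.comp W (F :\ f) w) = Defs.comp W F w.
  move=> wW; rewrite /hh; case: pickP => [x|/(_ w)]; last by rewrite !inE wW connect0.
  rewrite inE => /andP [xW wx]; symmetry; apply: comp_eq; apply: connect_sub wx => p q pq.
  by apply: connect1; move: pq; rewrite /adj inE => /andP [].
have imE : [set Defs.comp W F w | w in W] = hh @: [set Defs.comp W (F :\ f) w | w in W].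
  by rewrite -imset_comp; apply: eq_in_imset => w wW /=; rewrite hE.
rewrite /ncomp imE ltn_neqAle leq_imset_card andbT.
apply/negP => /imset_injP inj.
have : Defs.comp W (F :\ f) u = Defs.comp W (F :\ f) v.
  apply: inj; rewrite ?imset_f //.
  by rewrite !hE //; apply: comp_eq; apply: connect1; rewrite /adj -fE.
move/setP/(_ v); rewrite !inE vW connect0 /= => uv.
have [y []] := connect_cross uv uA vA.
by rewrite !inE => /andP [yf yF] /(cutA _ yF) E'; rewrite E' eqxx in yf.
Qed.

Lemma ncomp_le1P W F : reflect {in W &, forall u v, connect (adj F) u v} (ncomp W F <= 1).
Proof.
apply: (iffP idP) => [/card_le1_eqP le u v uW vW|h].
  have : Defs.comp W F v = Defs.comp W F u by apply: le; apply: imset_f.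
  by move/setP/(_ v); rewrite !inE vW connect0 /= => <-.
apply/card_le1_eqP => X Y /imsetP [u uW ->] /imsetP [v vW ->].
by apply: comp_eq; apply: h.
Qed.

Lemma two_edge_connected_tec W F : simple F -> (forall y, y \in F -> y \subset W) ->
  two_edge_connected W F -> tec F.
Proof.
move=> sF FW [/ncomp_le1P cn nb]; apply/tecP => // A d x y xF yF.
move=> /subsetPn [u ux]; rewrite inE negbK => uA /subsetPn [v vy vA].
have uW := subsetP (FW _ xF) _ ux; have vW := subsetP (FW _ yF) _ vy.
have [/exists_inP [f fF /andP [fA fd]]|nex] := boolP [exists f in F, crosses A f && (f != d)].
  by exists f.
have all_d z : z \in F -> crosses A z -> z = d.
  move=> zF zA; apply/eqP; apply: contraR nex => zd.
  by apply/exists_inP; exists z; rewrite // zA.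
have [z [zF zA]] := connect_cross (cn _ _ uW vW) uA vA.
have zd := all_d z zF zA; subst z.
by case/negP: (nb d); apply/bridgeP => //; split=> //; exists A.
Qed.

Lemma tec_two_edge_connected F : tec F -> two_edge_connected (cover F) F.
Proof.
move=> tF; have FW y : y \in F -> y \subset cover F by move=> yF; apply: (bigcup_sup y).
split.
  apply/ncomp_le1P => u v /bigcupP [x xF ux] /bigcupP [y yF vy].
  apply/negPn/negP => nuv; pose A := [set w | connect (adj F) u w].
  have xA : ~~ (x \subset ~: A) by apply/subsetPn; exists u; rewrite // !inE connect0.
  have yA : ~~ (y \subset A) by apply/subsetPn; exists v; rewrite // inE.
  have [f [fF fA _]] := tec_cross set0 tF xF yF xA yA.
  by move: (comp_ncrosses u (tec2 tF fF) fF); rewrite fA.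
move=> f; apply/negP => /(bridgeP _ (tec_simple tF) FW) [fF [A [fA cutA]]].
have [y [yF yA yf]] := tec_cross_other tF fF fA.
by rewrite (cutA y) ?eqxx in yf.
Qed.

Lemma cutC E S : simple E -> cut E (~: S) = cut E S.
Proof.
move=> /simpleP s2; apply/setP => f; rewrite !inE; case fE: (f \in E) => //=.
exact: crossesC (s2 _ fE).
Qed.

Lemma in_cut E S f : (f \in cut E S) = (f \in E) && crosses S f.
Proof. by rewrite inE. Qed.

Lemma minimal_cutC E S : simple E -> minimal_cut E S -> minimal_cut E (~: S).
Proof. by move=> sE mc S' S0 ST; rewrite cutC //; apply: mc. Qed.

(** If [A] splits [S] without an edge inside [S] crossing it, both parts have their cuts inside
    delta(S), hence equal to it by minimality. But an edge of delta(S) has its end in only one of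
    the parts. *)
Lemma minimal_cut_conn E S : simple E -> two_edge_connected [set: T] E ->
  S != set0 -> S != [set: T] -> minimal_cut E S -> conn E S.
Proof.
move=> sE [/ncomp_le1P cn _] S0 ST mc A nc; have s2 := simpleP _ sE.
have [|SA] := boolP (S \subset A); first by left.
have [|SA'] := boolP (S \subset ~: A); first by right.
exfalso.
have cutS B : (forall f, f \in E -> crosses B f = crosses A f) -> ~~ (S \subset ~: B) ->
    cut E (S :&: B) = cut E S.
  move=> BA nSB; apply: mc.
  - apply: contraNneq nSB => E'; apply/subsetP => v vS; rewrite inE; apply/negP => vB.
    by move/setP/(_ v): E'; rewrite !inE vS vB.
  - by apply: contraNneq ST => E'; rewrite eqEsubset subsetT -E' subsetIl.
  apply/subsetP => f; rewrite !in_cut => /andP [fE fB]; rewrite fE /=.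
  apply/negPn/negP => nfS; have fS : f \subset S by move: fB nfS; edge_cases (s2 _ fE).
  move: (nc f fE fS); rewrite -BA //; move: fB fS; edge_cases (s2 _ fE).
have E1 := cutS A (fun _ _ => erefl) SA'.
have E2 : cut E (S :&: ~: A) = cut E S.
  by apply: cutS; rewrite ?setCK // => f /s2; apply: crossesC.
have [u uS] := set0Pn _ S0.
have [v _ vS] : exists2 v, v \in [set: T] & v \notin S.
  by apply/subsetPn; apply: contra ST; rewrite eqEsubset subsetT.
have [f [fE fS]] := connect_cross (cn u v (in_setT _) (in_setT _)) uS vS.
have : f \in cut E S by rewrite in_cut fE.
move=> fc; have := fc; rewrite -{1}E1 in_cut => /andP [_ f1].
move: fc; rewrite -E2 in_cut => /andP [_ f2].
by move: fS f1 f2; edge_cases (s2 _ fE).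
Qed.

Lemma ncrossesU A B f : #|f| = 2 -> ~~ crosses A f -> ~~ crosses B f -> ~~ crosses (A :|: B) f.
Proof. by move=> f2; edge_cases f2. Qed.

(** The component of G[S] minus [f] that contains neither [e1] nor [e2] is [A], so delta(S,f)
    consists of the cut edges meeting [A]. *)
Lemma in_deltaWf E S e1 e2 A f g : simple E -> conn E S -> A \subset S -> f \in E ->
  f \subset S -> crosses A f -> (forall y, y \in E -> y \subset S -> crosses A y -> y = f) ->
  e1 \in E -> e1 \subset S -> e1 \subset ~: A -> e2 \in E -> e2 \subset ~: S ->
  (g \in deltaWf E S e1 e2 S f) = [&& g \in E, crosses S g & ~~ (g \subset ~: A)].
Proof.
move=> sE cn AS fE fS fA cutA e1E e1S e1A e2E e2S; have s2 := simpleP _ sE.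
rewrite inE in_cut -andbA; case gE: (g \in E) => //=; case gS: (crosses S g) => //=.
set F := induced E S :\ f.
have inF y : (y \in F) = [&& y != f, y \in E & y \subset S] by rewrite !inE.
have F2 y : y \in F -> #|y| = 2 by rewrite inF => /and3P [_ /s2].
have FA y : y \in F -> ~~ crosses A y.
  by rewrite inF => /and3P [yf yE yS]; apply: contra yf => /(cutA y yE yS) ->.
have ne2 v : ~~ (e2 \subset Defs.comp S F v).
  have [p [q [_ e2Eq]]] := edgeE (s2 _ e2E); apply/subsetPn; exists p.
    by rewrite e2Eq !inE eqxx.
  rewrite inE negb_and; apply/orP; left.
  by move: e2S; rewrite e2Eq subset2 inE => /andP [].
apply/exists_inP/subsetPn => [[v vg /andP [/andP [vS ne1] _]]|[v vg]].
  exists v => //; rewrite inE negbK; apply: contraR ne1 => vA.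
  pose C := [set w | connect (adj F) v w].
  have FC y : y \in F -> ~~ crosses C y by move=> yF; apply: comp_ncrosses (F2 _ yF) yF.
  have CA w : w \in C -> w \notin A.
    rewrite inE => vw; apply/negP => wA.
    rewrite adj_connect_sym in vw; have [y [yF yA]] := connect_cross vw wA vA.
    by move: (FA y yF); rewrite yA.
  (* If [f] leaves [C], then it ends in [A] and no edge inside [S] leaves [C :|: A]; otherwise no
     edge inside [S] leaves [C]. *)
  have SC : S \subset C :|: A.
    have [fC|fC] := boolP (crosses C f).
      have [y yE yS|//|SCA] := cn (C :|: A).
        case: (eqVneq y f) => [->|yf]; last first.
          have yF : y \in F by rewrite inF yf yE.
          by apply: ncrossesU (F2 _ yF) (FC _ yF) (FA _ yF).
        have [p [q [fEq pC qC]]] := crossesP (s2 _ fE) fC.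
        have qA : q \in A.
          move: fA; rewrite fEq crosses2; last by apply: contraNneq qC => <-.
          by rewrite (negbTE (CA p pC)).
        apply: sub_ncrosses; first exact: s2.
        by rewrite fEq subset2 !(in_setU) pC qA orbT.
      by move: (subsetP SCA v vS); rewrite !inE connect0.
    have [y yE yS|SC|SC] := cn C.
    - case: (eqVneq y f) => [->//|yf]; apply: FC; by rewrite inF yf yE.
    - exact: subset_trans SC (subsetUl _ _).
    - by move: (subsetP SC v vS); rewrite !inE connect0.
  apply/subsetP => w we; have wS := subsetP e1S _ we.
  move: (subsetP SC w wS) (subsetP e1A w we); rewrite !inE wS => /orP [//|->].
  by [].
rewrite inE negbK => vA; exists v => //; rewrite (subsetP AS) //= ne2 andbT.
apply/negP => /subsetP sub.
have [p [q [_ e1Eq]]] := edgeE (s2 _ e1E).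
have pe : p \in e1 by rewrite e1Eq !inE eqxx.
have := sub p pe; rewrite inE => /andP [_ vp].
have pA : p \notin A by move: (subsetP e1A p pe); rewrite inE.
have [y [yF yA]] := connect_cross vp vA pA.
by move: (FA y yF); rewrite yA.
Qed.

Lemma deltaWfC E S e1 e2 W f : simple E ->
  deltaWf E (~: S) e2 e1 W f = deltaWf E S e1 e2 W f.
Proof.
move=> sE; apply/setP => g; rewrite !inE -!in_cut cutC //; congr (_ && _).
by apply: eq_existsb => v; congr (_ && _); rewrite andbAC.
Qed.

End Translation.

(** * The connectivity cut inequality *)

Section FacetConditions.
Variables (T : finType) (R : realType).
Implicit Types (A B C D S W f g h c d i j x y z e : {set T}) (E F G H K M N X Y Z I J : {set {set T}}).

(** Equality in the inequality at the incidence vector of [H], with the negative term moved to the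
    right to stay in the natural numbers. *)
Definition tight_set E S e1 e2 H :=
  (e1 \in H).*2 + (e2 \in H).*2 == #|H :&: cut E S| + 2.

Lemma tight_setC E S e1 e2 H : simple E ->
  tight_set E (~: S) e2 e1 H = tight_set E S e1 e2 H.
Proof. by move=> sE; rewrite /tight_set cutC // addnC. Qed.

Lemma capcut0 E S H : H \subset E -> #|H :&: cut E S| = 0 <->
  (forall f, f \in H -> ~~ crosses S f).
Proof.
move=> HE; split=> [/cards0_eq h f fH|h].
  by apply/negP => fS; move/setP/(_ f): h; rewrite inE in_cut fH (subsetP HE) // fS inE.
apply/eqP; rewrite cards_eq0 -subset0; apply/subsetP => f; rewrite inE in_cut.
by case/and3P => fH _ fS; move: (h f fH); rewrite fS.
Qed.

Lemma tight_setP E S e1 e2 H : H \subset E -> tight_set E S e1 e2 H ->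
  [\/ [/\ e1 \in H, e2 \notin H & forall f, f \in H -> ~~ crosses S f],
      [/\ e1 \notin H, e2 \in H & forall f, f \in H -> ~~ crosses S f] |
      [/\ e1 \in H, e2 \in H & #|H :&: cut E S| = 2]].
Proof.
move=> HE; rewrite /tight_set => /eqP.
case e1H: (e1 \in H); case e2H: (e2 \in H).
- by move=> h; constructor 3; split=> //; apply/eqP; rewrite -(eqn_add2r 2) -h.
- by move=> h; constructor 1; split=> //; apply/(capcut0 S HE)/eqP; rewrite -(eqn_add2r 2) -h.
- by move=> h; constructor 2; split=> //; apply/(capcut0 S HE)/eqP; rewrite -(eqn_add2r 2) -h.
- by rewrite addn2.
Qed.

Lemma tight_set_le E S e1 e2 H : tec H -> H \subset E -> e1 \subset S -> e2 \subset ~: S ->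
  (e1 \in H).*2 + (e2 \in H).*2 <= #|H :&: cut E S| + 2.
Proof.
move=> tH HE e1S e2S.
case e1H: (e1 \in H); case e2H: (e2 \in H); rewrite ?addn0 ?add0n ?leq_addl //.
rewrite leq_add2r.
have n1 : ~~ (e1 \subset ~: S) by apply: sub_nsubC e1S; apply: tec2 tH _.
have n2 : ~~ (e2 \subset S) by rewrite -[S]setCK; apply: sub_nsubC e2S; apply: tec2 tH _.
have [g [gH gS _]] := tec_cross set0 tH e1H e2H n1 n2.
have [h [hH hS hg]] := tec_cross g tH e1H e2H n1 n2.
apply/card_gt1P; exists h, g.
by rewrite !inE hH gH !(subsetP HE) //; split.
Qed.

Local Open Scope ring_scope.

(** By [facet_annihilated], this is the facet property. *)
Definition annihilated E S e1 e2 := forall a : {set T} -> R,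
  (forall H, tec H -> H \subset E -> tight_set E S e1 e2 H -> wt a H = 0) ->
  forall H, tec H -> H \subset E -> wt a H = 0.

Lemma annihilatedC E S e1 e2 : simple E ->
  annihilated E (~: S) e2 e1 <-> annihilated E S e1 e2.
Proof.
by move=> sE; split=> h a a0; apply: h => H tH HE; [rewrite tight_setC // | rewrite -tight_setC //]; apply: a0.
Qed.

Lemma wt_indicator H Y : wt (fun f => (f \in Y)%:R : R) H = #|H :&: Y|%:R.
Proof.
rewrite /wt -sum1_card natr_sum [RHS]big_mkcond [LHS]big_mkcond; apply: eq_bigr => f _.
by rewrite inE; case: (f \in H); case: (f \in Y).
Qed.

Lemma wt_lin (p q : {set T} -> R) (k : R) H : wt (fun f => p f - k * q f) H = wt p H - k * wt q H.
Proof. by rewrite /wt sumrB mulr_sumr. Qed.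

Lemma card_cap1 e H : #|H :&: [set e]| = (e \in H) :> nat.
Proof.
case eH: (e \in H); first by rewrite (setIidPr _) ?cards1 ?sub1set.
apply/eqP; rewrite cards_eq0 -subset0; apply/subsetP => f; rewrite !inE => /andP [fH /eqP E'].
by rewrite E' eH in fH.
Qed.

(** The functional x(delta(S)) - 2 x_{e1} vanishes on tight subgraphs: one containing [e1] but no
    cut edge would lie inside [S], where [e1] is a bridge. Its value at [E] gives the claim. *)
Lemma bridge_needs_two E S e1 e2 : tec E -> e1 \in E -> e1 \subset S ->
  bridge S (induced E S) e1 -> annihilated E S e1 e2 -> #|cut E S| = 2%N.
Proof.
move=> tE e1E e1S br ann.
have sI : simple (induced E S).
  by apply: simpleS (tec_simple tE); apply/subsetP => f; rewrite inE => /andP [].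
have IS y : y \in induced E S -> y \subset S by rewrite inE => /andP [].
have [_ [A [e1A cutA]]] := bridgeP _ sI IS br.
have := ann (fun f => (f \in cut E S)%:R - 2 * (f \in [set e1])%:R) _ E tE (subxx E).
rewrite wt_lin !wt_indicator card_cap1 e1E (setIidPr _); last first.
  by apply/subsetP => f; rewrite in_cut => /andP [].
move=> h; apply/eqP; rewrite -(eqr_nat R) -subr_eq0 -[X in _ - X]mulr1; apply/eqP; apply: h.
move=> H tH HE /(tight_setP HE) tg.
rewrite wt_lin !wt_indicator card_cap1.
case: tg => [[e1H _ nc]|[e1H _ nc]|[e1H _ n2]].
- have HS y : y \in H -> y \subset S.
    move=> yH; apply: (tec_in tH nc e1H _ yH).
    by apply: sub_nsubC e1S; apply: tec2 tH _.
  have [y [yH yA ye]] := tec_cross_other tH e1H e1A.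
  by rewrite (cutA y) ?inE ?eqxx ?(subsetP HE) ?HS in ye.
- by have /(capcut0 S HE) -> := nc; rewrite (negbTE e1H) mulr0 subr0.
- by rewrite n2 e1H mulr1 subrr.
Qed.

(** The functional is x_f - x(delta(S,f)). A tight subgraph without cut edges avoids [f]; one with
    two cut edges contains [f] exactly when one of them meets the part [A] behind [f], and they
    never both do. *)
Lemma facet_delta1 E S e1 e2 f : tec E -> conn E S -> e1 \in E -> e1 \subset S ->
  e2 \in E -> e2 \subset ~: S ->
  ~~ bridge S (induced E S) e1 -> annihilated E S e1 e2 ->
  bridge S (induced E S) f -> #|deltaWf E S e1 e2 S f| = 1%N.
Proof.
move=> tE cn e1E e1S e2E e2S nb ann br.
have sE := tec_simple tE; have E2 := simpleP _ sE.
have sI : simple (induced E S).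
  by apply: simpleS sE; apply/subsetP => y; rewrite inE => /andP [].
have IS y : y \in induced E S -> y \subset S by rewrite inE => /andP [].
have [fI [A0 [fA0 cutA0]]] := bridgeP _ sI IS br.
move: (fI); rewrite inE => /andP [fE fS].
have {}cutA0 y : y \in E -> y \subset S -> crosses A0 y -> y = f.
  by move=> yE yS; apply: cutA0; rewrite inE yE.
have ef : e1 != f by apply: contraNneq nb => ->.
have e1A0 : ~~ crosses A0 e1 by apply: contra ef => /(cutA0 _ e1E e1S) ->.
(* Of the two sides of the bridge, the one without [e1] is chosen and intersected with [S]. *)
have [A [AS e1A fA cutA]] : exists A, [/\ A \subset S, e1 \subset ~: A, crosses A f &
    forall y, y \in E -> y \subset S -> crosses A y -> y = f].
  have sub B : (forall y, y \in E -> crosses B y = crosses A0 y) -> e1 \subset ~: B ->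
     exists A, [/\ A \subset S, e1 \subset ~: A, crosses A f &
    forall y, y \in E -> y \subset S -> crosses A y -> y = f].
    move=> BA e1B; exists (B :&: S).
    have BE y : y \in E -> y \subset S -> crosses (B :&: S) y = crosses A0 y.
      by move=> yE yS; rewrite -BA //; move: yS; edge_cases (E2 _ yE).
    split; first exact: subsetIr.
    - by apply: subset_trans e1B _; rewrite setCS subsetIl.
    - by rewrite BE.
    - by move=> y yE yS; rewrite BE //; apply: cutA0.
  case/orP: (ncrosses_side (E2 _ e1E) e1A0) => h; last exact: (sub A0).
  by apply: (sub (~: A0)); rewrite ?setCK // => y yE; apply: crossesC (E2 _ yE).
have inD g := in_deltaWf g sE cn AS fE fS fA cutA e1E e1S e1A e2E e2S.
set Dl := deltaWf E S e1 e2 S f in inD *.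
have := ann (fun y => (y \in [set f])%:R - 1 * (y \in Dl)%:R) _ E tE (subxx E).
rewrite wt_lin !wt_indicator card_cap1 fE (setIidPr _); last first.
  by apply/subsetP => g; rewrite inD => /and3P [].
move=> h; apply/eqP; rewrite -(eqr_nat R) eq_sym -subr_eq0 -[X in _ - X]mul1r; apply/eqP; apply: h.
move=> H tH HE /(tight_setP HE) tg; rewrite wt_lin !wt_indicator card_cap1 mul1r.
have H2 y : y \in H -> #|y| = 2%N by apply: tec2.
have nf x y d : x \in H -> ~~ (x \subset ~: A) -> y \in H -> ~~ (y \subset A) ->
    (forall z, z \in H -> crosses A z -> z = d) -> False.
  move=> xH xA yH yA hd; have [z [zH zA zd]] := tec_cross d tH xH yH xA yA.
  by rewrite (hd z zH zA) eqxx in zd.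
have crossA z : z \in H -> crosses A z -> z = f \/ crosses S z.
  move=> zH zA; have [|zS] := boolP (crosses S z); [by right|left].
  apply: cutA => //; first exact: (subsetP HE).
  have AS' := subsetP AS; have [u [v [zE uA vA]]] := crossesP (H2 _ zH) zA.
  case/orP: (ncrosses_side (H2 _ zH) zS) => // zS'.
  by move: (subsetP zS' u); rewrite zE !inE eqxx AS' // => /(_ isT).
have DlA g : g \in Dl -> crosses A g.
  rewrite inD => /and3P [gE gS gA]; have [u [v [gEq uS vS]]] := crossesP (E2 _ gE) gS.
  have vA : v \notin A by apply: contra vS; apply: (subsetP AS).
  move: gA; rewrite gEq subset2 !inE vA andbT negbK => uA.
  by rewrite crosses2 ?uA ?(negbTE vA) //; apply: contraNneq vS => <-.
have fH0 : (forall y, y \in H -> ~~ crosses S y) -> (f \in H)%:R - #|H :&: Dl|%:R = 0 :> R.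
  move=> nc; have -> : #|H :&: Dl| = 0%N.
    apply/eqP; rewrite cards_eq0 -subset0; apply/subsetP => g; rewrite inE inD.
    by case/and4P => gH _ gS _; move: (nc g gH); rewrite gS.
  suff -> : f \in H = false by rewrite subrr.
  apply/negP => fH; apply: (nf f f f) => //; [exact: crosses_nsubC (E2 _ fE) fA | exact: crosses_nsub (E2 _ fE) fA|].
  by move=> z zH zA; case: (crossA z zH zA) => // zS; move: (nc z zH); rewrite zS.
case: tg => [[_ _ nc]|[_ _ nc]|[e1H e2H n2]]; try exact: fH0.
have /eqP/cards2P [g [h [gh HC]]] := n2.
have memHC y : (y \in H) && crosses S y = (y == g) || (y == h).
  move/setP/(_ y): HC; rewrite !inE => <-; case yH: (y \in H) => //=.
  by rewrite (subsetP HE _ yH).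
have [gH gS] : g \in H /\ crosses S g by apply/andP; rewrite memHC eqxx.
have [hH hS] : h \in H /\ crosses S h by apply/andP; rewrite memHC eqxx orbT.
have [gE hE] : g \in E /\ h \in E by split; apply: (subsetP HE).
have cutH z : z \in H -> crosses A z -> [\/ z = f, z = g | z = h].
  move=> zH zA; case: (crossA z zH zA) => [->|zS]; first by constructor 1.
  have : (z \in H) && crosses S z by rewrite zH.
  by rewrite memHC => /orP [] /eqP ->; [constructor 2|constructor 3].
have gnf : g != f by apply: contraTneq gS => ->; apply: sub_ncrosses fS; apply: E2.
have hnf : h != f by apply: contraTneq hS => ->; apply: sub_ncrosses fS; apply: E2.
have gD : (g \in Dl) = crosses A g.
  apply/idP/idP => [/DlA //|gA]; rewrite inD gE gS /=; exact: crosses_nsubC (E2 _ gE) gA.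
have hD : (h \in Dl) = crosses A h.
  apply/idP/idP => [/DlA //|hA]; rewrite inD hE hS /=; exact: crosses_nsubC (E2 _ hE) hA.
have -> : #|H :&: Dl| = ((g \in Dl) + (h \in Dl))%N.
  have -> : H :&: Dl = Dl :&: [set g; h].
    apply/setP => y; rewrite !in_setI in_set2 -memHC.
    by case yD: (y \in Dl); rewrite ?andbF //=; move: yD; rewrite inD => /and3P [_ -> _].
  rewrite setIUr cardsU !card_cap1.
  have -> : Dl :&: [set g] :&: (Dl :&: [set h]) = set0.
    apply/setP => y; rewrite !in_setI !in_set1 in_set0.
    by case: (eqVneq y g) => [->|_]; rewrite ?andbF // (negbTE gh) !andbF.
  by rewrite cards0 subn0.
have e1nA : ~~ (e1 \subset A) by move: e1A; edge_cases (E2 _ e1E).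
rewrite gD hD; case gA: (crosses A g); case hA: (crosses A h).
(* If both cut edges left [A], only [f] could leave [S :\: A], which contains [e1]. *)
- exfalso.
  have e1D : ~~ (e1 \subset ~: (S :\: A)) by move: e1A e1S; edge_cases (E2 _ e1E).
  have gnD : ~~ (g \subset S :\: A) by move: gS; edge_cases (E2 _ gE).
  have [z [zH zD zf]] := tec_cross f tH e1H gH e1D gnD.
  have noD y : y \in E -> crosses S y -> crosses A y -> ~~ crosses (S :\: A) y.
    move=> yE yS yA; have [u [v [yEq uS vS]]] := crossesP (E2 _ yE) yS.
    have uv : u != v by apply: contraNneq vS => <-.
    have vA : (v \in A) = false by apply/negP => /(subsetP AS); apply/negP.
    by move: yA; rewrite yEq !crosses2 // !inE vA (negbTE vS) addbF => ->.
  have [zS|zS] := boolP (crosses S z).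
    have : (z \in H) && crosses S z by rewrite zH.
    by rewrite memHC => /orP [] /eqP E'; subst z; move: zD; apply/negP; apply: noD.
  case/eqP: zf; apply: cutA; first exact: (subsetP HE).
    by move: zD zS; edge_cases (H2 _ zH).
  by move: zD zS; edge_cases (H2 _ zH).
- have -> : f \in H; last by rewrite subrr.
  have [y [yH yA yg]] := tec_cross_other tH gH gA.
  by case: (cutH y yH yA) => E'; subst y; rewrite // ?eqxx // hA in yg yA.
- have -> : f \in H; last by rewrite subrr.
  have [y [yH yA yh]] := tec_cross_other tH hH hA.
  by case: (cutH y yH yA) => E'; subst y; rewrite // ?eqxx // gA in yh yA.
- suff -> : f \in H = false by rewrite subrr.
  apply/negP => fH; have [y [yH yA yf]] := tec_cross_other tH fH fA.
  by case: (cutH y yH yA) => E'; subst y; [rewrite eqxx in yf|rewrite gA in yA|rewrite hA in yA].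
Qed.

End FacetConditions.

(** * Case (i), and the facet criterion for the inequality *)

Section Final.
Variables (T : finType) (R : realType).
Implicit Types (A B C D S W f g h c d i j x y z e : {set T}) (E F G H K M N X Y Z I J : {set {set T}}).

(** The bridge [e1] is equivalent to both cut edges, so every subgraph through [e2] is tight and
    [wt_cls_eq0_edge] applies to [e2]. *)
Lemma two_cut_annihilated E S e1 e2 : tec E -> e1 \in E -> e1 \subset S ->
  e2 \in E -> e2 \subset ~: S -> bridge S (induced E S) e1 -> #|cut E S| = 2 ->
  annihilated R E S e1 e2.
Proof.
move=> tE e1E e1S e2E e2S br n2; have E2 := simpleP _ (tec_simple tE).
have sI : simple (induced E S).
  by apply: simpleS (tec_simple tE); apply/subsetP => f; rewrite inE => /andP [].
have IS y : y \in induced E S -> y \subset S by rewrite inE => /andP [].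
have [_ [A [e1A cutA]]] := bridgeP _ sI IS br.
have {}cutA y : y \in E -> y \subset S -> crosses A y -> y = e1.
  by move=> yE yS; apply: cutA; rewrite inE yE.
have /eqP/cards2P [g [h [gh HC]]] := n2.
have memC y : (y \in E) && crosses S y = (y == g) || (y == h).
  by move/setP/(_ y): HC; rewrite !inE.
have [gE gS] : g \in E /\ crosses S g by apply/andP; rewrite memC eqxx.
have [hE hS] : h \in E /\ crosses S h by apply/andP; rewrite memC eqxx orbT.
have cutS y : y \in E -> crosses S y -> y = g \/ y = h.
  move=> yE yS; have : (y \in E) && crosses S y by rewrite yE.
  by rewrite memC => /orP [] /eqP; [left|right].
have eqgh : eqv E g h by apply: (cut_eqv gS hS cutS).
have e1B : crosses (A :&: S) e1 by move: e1A e1S; edge_cases (E2 _ e1E).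
have cutB y : y \in E -> crosses (A :&: S) y -> y = e1 \/ crosses S y.
  move=> yE yB; have [|yS] := boolP (crosses S y); [by right|left].
  by apply: cutA => //; move: yB yS; edge_cases (E2 _ yE).
(* Exactly one of [g] and [h] leaves [A :&: S], and it forms a 2-edge cut with [e1]: if both did,
   [e1] alone would leave [S :\: A]; if neither did, [e1] alone would leave [A :&: S]. *)
have eqe1 : eqv E e1 g.
  have one p q : eqv E p g -> q = g \/ q = h -> p = g \/ p = h -> p != q ->
      crosses (A :&: S) p -> ~~ crosses (A :&: S) q -> eqv E e1 g.
    move=> pg qgh pgh pq pB qB; apply: eqv_trans pg; apply: (cut_eqv e1B pB) => y yE yB.
    case: (cutB y yE yB) => [|yS]; [by left|right].
    suff [//|E'] : y = p \/ y = q by rewrite E' (negbTE qB) in yB.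
    case: (cutS y yE yS) => ->; case: pgh pq => ->; case: qgh => ->; rewrite ?eqxx //; by [left|right].
  have [gB|gB] := boolP (crosses (A :&: S) g); have [hB|hB] := boolP (crosses (A :&: S) h).
  - have e1D : crosses (S :\: A) e1 by move: e1A e1S; edge_cases (E2 _ e1E).
    have [y [yE yD ye]] := tec_cross_other tE e1E e1D.
    have [yS|yS] := boolP (crosses S y).
      have yB : crosses (A :&: S) y by case: (cutS y yE yS) => ->.
      by move: yD yB yS; edge_cases (E2 _ yE).
    case/eqP: ye; apply: cutA => //; move: yD yS; edge_cases (E2 _ yE).
  - by apply: (one g h) => //; [apply: eqv_refl|right|left].
  - by apply: (one h g) => //; [rewrite eqv_sym|left|right|rewrite eq_sym].
  - have [y [yE yB ye]] := tec_cross_other tE e1E e1B.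
    case: (cutB y yE yB) => [E'|yS]; first by rewrite E' eqxx in ye.
    by case: (cutS y yE yS) => E'; subst y; [rewrite yB in gB|rewrite yB in hB].
move=> a a0; apply: wt_tec_eq0; apply: (wt_cls_eq0_edge tE e2E) => H tH e2H HE.
apply: a0 => //; rewrite /tight_set e2H.
have cap : #|H :&: cut E S| = (e1 \in H).*2.
  have gH : (g \in H) = (e1 \in H) by rewrite (eqvP _ _ _ eqe1).
  have hH : (h \in H) = (e1 \in H) by rewrite -gH (eqvP _ _ _ eqgh).
  case e1H: (e1 \in H) in gH hH *.
    by rewrite (setIidPr _) ?n2 // HC subset2 gH.
  apply/(capcut0 S HE) => y yH; apply/negP => yS.
  by case: (cutS y (subsetP HE _ yH) yS) => E'; subst y; rewrite yH in gH hH.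
by rewrite cap.
Qed.

Lemma sides_annihilated E S e1 e2 : tec E -> side E S e1 -> side E (~: S) e2 ->
  annihilated R E S e1 e2.
Proof.
move=> tE sd1 sd2 a a0; have [_ e1S _ _ _] := sd1; have [_ e2S _ _ _] := sd2.
have E2 := simpleP _ (tec_simple tE).
apply: (tight_kills tE sd1 sd2).
- move=> H tH e1H HL.
  have HE : H \subset E := subset_trans HL (core_subE _ _ _).
  have HS y : y \in H -> y \subset S by move/(subsetP HL)/core_sub => [].
  apply: a0 => //; rewrite /tight_set e1H.
  have -> : e2 \in H = false.
    by apply/negP => e2H; move: (HS _ e2H); apply/negP; rewrite -[S]setCK; apply: sub_nsubC e2S; apply: tec2 tH _.
  have /(capcut0 S HE) -> // : forall y, y \in H -> ~~ crosses S y.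
  by move=> y yH; apply: sub_ncrosses (tec2 tH yH) (HS _ yH).
- move=> H tH e2H HL.
  have HE : H \subset E := subset_trans HL (core_subE _ _ _).
  have HS y : y \in H -> y \subset ~: S by move/(subsetP HL)/core_sub => [].
  apply: a0 => //; rewrite /tight_set e2H.
  have -> : e1 \in H = false.
    by apply/negP => e1H; move: (HS _ e1H); apply/negP; apply: sub_nsubC e1S; apply: tec2 tH _.
  have /(capcut0 S HE) -> // : forall y, y \in H -> ~~ crosses S y.
  by move=> y yH; apply: subC_ncrosses (tec2 tH yH) (HS _ yH).
- move=> H g h tH HE e1H e2H gh gH hH gS hS cutH; apply: a0 => //.
  rewrite /tight_set e1H e2H; have -> : H :&: cut E S = [set g; h].
    apply/setP => y; rewrite in_setI in_cut in_set2; apply/and3P/orP => [[yH _ yS]|].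
      by case: (cutH y yH yS) => ->; [left|right].
    by case=> /eqP ->; split=> //; apply: (subsetP HE).
  by rewrite cards2 gh.
Qed.

Lemma side_intro E S e1 e2 : tec E -> conn E S -> e1 \in E -> e1 \subset S ->
  e2 \in E -> e2 \subset ~: S -> ~~ bridge S (induced E S) e1 ->
  (forall f, bridge S (induced E S) f -> #|deltaWf E S e1 e2 S f| = 1) -> side E S e1.
Proof.
move=> tE cn e1E e1S e2E e2S nb del.
have sI : simple (induced E S).
  by apply: simpleS (tec_simple tE); apply/subsetP => f; rewrite inE => /andP [].
have IS y : y \in induced E S -> y \subset S by rewrite inE => /andP [].
split=> // [A e1A|A f AS fE fS fA cutA e1A g h gE hE gS hS gA hA].
  have [/exists_inP [f fE /and3P [fS fA fe]]|nex] :=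
      boolP [exists f in E, [&& f \subset S, crosses A f & f != e1]]; first by exists f.
  case/negP: nb; apply/bridgeP => //; split; first by rewrite inE e1E.
  exists A; split=> // y; rewrite inE => /andP [yE yS] yA; apply/eqP.
  by apply: contraR nex => ye; apply/exists_inP; exists y; rewrite // yS yA.
have br : bridge S (induced E S) f.
  apply/bridgeP => //; split; first by rewrite inE fE.
  by exists A; split=> // y; rewrite inE => /andP [yE yS]; apply: cutA.
have inD y := in_deltaWf y (tec_simple tE) cn AS fE fS fA cutA e1E e1S e1A e2E e2S.
have /eqP/cards1P [k kE] := del f br.
have : g \in deltaWf E S e1 e2 S f by rewrite inD gE gS.
have : h \in deltaWf E S e1 e2 S f by rewrite inD hE hS.
by rewrite kE !inE => /eqP -> /eqP ->.
Qed.

Local Open Scope ring_scope.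

Lemma tec_vectorsP E (y : vec T R) : simple E ->
  tec_vectors E y <-> exists2 F : {set {set T}}, (F \subset E) && tec F & {in E, y =1 chi R F}.
Proof.
move=> sE; split=> [[W [F [[FE FW] [tF yF]]]]|[F /andP [FE tF] yF]].
  exists F => //; rewrite FE /=; apply: two_edge_connected_tec FW tF.
  exact: simpleS FE sE.
exists (cover F), F; split; last by split=> //; apply: tec_two_edge_connected.
by split=> // f fF; apply: (bigcup_sup f).
Qed.

Lemma facet_annihilated E S e1 e2 : tec E -> e1 \in E -> e1 \subset S ->
  e2 \in E -> e2 \subset ~: S ->
  @defines_facet T R E (@TECSP T R E)
    (fun x : vec T R => 2 * x e1 - \sum_(f in cut E S) x f + 2 * x e2) 2 <->
  annihilated R E S e1 e2.
Proof.
move=> tE e1E e1S e2E e2S.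
pose l f : R := 2 * (f == e1)%:R - (f \in cut E S)%:R + 2 * (f == e2)%:R.
have lE (x : vec T R) : 2 * x e1 - \sum_(f in cut E S) x f + 2 * x e2 = \sum_(f in E) l f * x f.
  have pt e : e \in E -> \sum_(f in E) (2 * (f == e)%:R) * x f = 2 * x e.
    move=> eE; rewrite (bigD1 e) //= eqxx mulr1 big1 ?addr0 // => f /andP [_ /negbTE ->].
    by rewrite mulr0 mul0r.
  transitivity (\sum_(f in E) (2 * (f == e1)%:R * x f - (f \in cut E S)%:R * x f +
      2 * (f == e2)%:R * x f)); last by apply: eq_bigr => f _; rewrite -mulrBl -mulrDl.
  rewrite big_split sumrB /= !pt //; congr (_ - _ + _).
  rewrite [RHS](big_setID (cut E S)) /= [X in _ = _ + X]big1 ?addr0.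
    rewrite (setIidPr _); last by apply/subsetP => f; rewrite in_cut => /andP [].
    by apply: eq_bigr => f ->; rewrite mul1r.
  by move=> f; rewrite in_setD => /andP [/negbTE -> _]; rewrite mul0r.
have -> : (fun x : vec T R => 2 * x e1 - \sum_(f in cut E S) x f + 2 * x e2) =
    (fun x : vec T R => \sum_(f in E) l f * x f) by apply: funext.
have lchi H : \sum_(f in E) l f * chi R H f =
    ((e1 \in H).*2 + (e2 \in H).*2)%N%:R - #|H :&: cut E S|%:R.
  rewrite -lE /chi -wt_indicator -!mul2n natrD !natrM addrAC; congr (_ - _).
  by rewrite wt_indicator setIC -wt_indicator.
have two0 : (2 : R) != 0 by rewrite pnatr_eq0.
pose P := [pred F : {set {set T}} | (F \subset E) && tec F].
have val F : P F -> \sum_(f in E) l f * chi R F f <= 2.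
  move=> /andP [FE tF]; rewrite lchi lerBlDl -natrD ler_nat.
  exact: tight_set_le.
have tightE F : tight E P l 2 F = P F && tight_set E S e1 e2 F.
  by rewrite /tight lchi subr_eq -natrD eqr_nat [(2 + _)%N]addnC.
rewrite (@facetP T R E (tec_vectors E) P _ _ l 2 two0 val); last 3 first.
- by move=> y; apply: tec_vectorsP; apply: tec_simple.
- by rewrite /= sub0set tec0.
- by move=> F /andP [].
split=> h a a0.
  move=> H tH HE; apply: h; last by rewrite /= HE.
  by move=> F; rewrite tightE => /andP [/andP [FE tF] tg]; apply: a0.
move=> F /andP [FE tF]; apply: h => // H tH HE tg; apply: a0.
by rewrite tightE tg andbT /= HE.
Qed.

End Final.

Local Open Scope ring_scope.

Theorem mainTheorem8 (R : realType) (T : finType) (E : {set {set T}})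
    (S e1 e2 : {set T}) :
  simple_edges E ->
  two_edge_connected [set: T] E ->
  S != set0 -> S != [set: T] ->
  minimal_cut E S ->
  e1 \in induced E S -> e2 \in induced E (~: S) ->
  @defines_facet T R E (@TECSP T R E)
    (fun x => 2 * x e1 - \sum_(f in cut E S) x f + 2 * x e2) 2
  <->
  (((bridge S (induced E S) e1 || bridge (~: S) (induced E (~: S)) e2)
      /\ #|cut E S| = 2%N)
   \/
   (~~ bridge S (induced E S) e1 /\ ~~ bridge (~: S) (induced E (~: S)) e2 /\
    forall W : {set T}, (W = S \/ W = ~: S) ->
      forall f, bridge W (induced E W) f -> #|deltaWf E S e1 e2 W f| = 1%N)).
Proof.
move=> sE0 t2 S0 ST mc; rewrite !inE => /andP [e1E e1S] /andP [e2E e2S].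
have sE : simple E by apply/simpleP.
have tE : tec E by apply: two_edge_connected_tec t2 => // y _; apply: subsetT.
have cn1 : conn E S by apply: minimal_cut_conn.
have cn2 : conn E (~: S).
  apply: minimal_cut_conn => //; last exact: minimal_cutC.
    by apply: contra ST => /eqP E'; rewrite -[S]setCK E' setC0.
  by apply: contra S0 => /eqP E'; rewrite -[S]setCK E' setCT.
have e1S' : e1 \subset ~: ~: S by rewrite setCK.
rewrite facet_annihilated //; split=> [ann|].
  (* Statements on the shore of [e2] follow by exchanging [S] with its complement and [e1] with
     [e2]. *)
  have ann' : annihilated R E (~: S) e2 e1 by apply/annihilatedC.
  have [br1|nb1] := boolP (bridge S (induced E S) e1).
    by left; split=> //; apply: bridge_needs_two br1 ann.
  have [br2|nb2] := boolP (bridge (~: S) (induced E (~: S)) e2).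
    by left; split=> //; rewrite -cutC //; apply: bridge_needs_two br2 ann'.
  right; do 2!split=> //; move=> W [] -> f br; first exact: facet_delta1 nb1 ann br.
  by rewrite -deltaWfC //; apply: facet_delta1 nb2 ann' br.
case=> [[/orP [br|br] n2]|[nb1 [nb2 del]]].
- exact: two_cut_annihilated.
- by apply/annihilatedC => //; apply: two_cut_annihilated => //; rewrite cutC.
apply: sides_annihilated => //.
  by apply: (side_intro tE cn1 e1E e1S e2E e2S nb1) => f; apply: del; left.
apply: (side_intro tE cn2 e2E e2S e1E e1S' nb2) => f br.
by rewrite deltaWfC //; apply: del; rewrite //; right.
Qed.
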